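(* Assume that $\nabla\nu\in [L^\infty(\bar{Q})]^d$. Let $\gamma\in(0,2)$ and $\varepsilon>0$ be arbitrary, put $$\alpha := \frac{\|\nabla\nu\|_{\infty}^2}{\gamma\nu_{\mathrm{min}}}+\frac{1}{\varepsilon T},$$ and let the time-step size $\tau=T/N>0$, $N\in\mathbb{N}$, satisfy $\tau<\alpha^{-1}$. Suppose that $(\boldsymbol{u}_{n+1},p_{n+1})\in [H^1_0(\Omega)]^d\times [L^2_0(\Omega)\cap H^1(\Omega)]$, $n=0,\dots,N-1$, satisfy, starting from the initial velocity $\boldsymbol{u}_0$ and $p_0=p_{-1}=0$, the fractional-step implicit-explicit generalised Laplacian scheme $$\frac{1}{\tau}(\boldsymbol{u}_{n+1}-\boldsymbol{u}_{n},\boldsymbol{w})+(\nu_{n}\nabla\boldsymbol{u}_{n+1},\nabla\boldsymbol{w}) +((\nabla\boldsymbol{u}_{n+1})\boldsymbol{u}_{n},\boldsymbol{w}) + \frac{1}{2}((\nabla\cdot\boldsymbol{u}_n)\boldsymbol{u}_{n+1},\boldsymbol{w}) = (2p_{n}-p_{n-1},\nabla\cdot\boldsymbol{w})+(\nabla^{\top}\boldsymbol{u}_{n}\nabla\nu_n,\boldsymbol{w}) + (\boldsymbol{w},\boldsymbol{f}_{n+1}),$$ $$\tau(\nabla(p_{n+1}-p_{n}),\nabla q) + (\nabla\cdot\boldsymbol{u}_{n+1},q) = 0,$$ for all $(\boldsymbol{w},q)\in [H^1_0(\Omega)]^d\times [L^2_0(\Omega)\cap H^1(\Omega)]$ and all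 $n=0,\dots,N-1$. Then $$\|\boldsymbol{u}_{N}\|^2 +\gamma\tau\big\|\sqrt{\nu_{N-1}}\,\nabla \boldsymbol{u}_{N}\big\|^2 + \tau^2\|\nabla p_{N}\|^2 + \sum_{n=1}^{N}\tau\Big[(2-\gamma)\big\|\sqrt{\nu_{n-1}}\,\nabla\boldsymbol{u}_{n}\big\|^2 +\alpha\tau^2\|\nabla p_{n}\|^2\Big] \leq \exp\left(\frac{\alpha T}{1-\alpha\tau}\right)\left[\|\boldsymbol{u}_0 \|^2 + \gamma\tau\nu_{\mathrm{min}}\|\nabla\boldsymbol{u}_0\|^2 + \varepsilon T\sum_{n=1}^{N}\tau\| \boldsymbol{f}_n\|^2\right].$$
   Context: Setting: $\Omega\subset\mathbb{R}^d$, $d=2$ or $3$, is a bounded domain with Lipschitz boundary, $T>0$, and $Q=\Omega\times(0,T]$. The problem discretised in time is the incompressible Navier--Stokes system $\partial_t\boldsymbol{u}+(\nabla\boldsymbol{u})\boldsymbol{u}-\nabla\cdot[2\nu\nabla^{\mathrm{s}}\boldsymbol{u}]+\nabla p=\boldsymbol{f}$, $\nabla\cdot\boldsymbol{u}=0$ in $Q$, $\boldsymbol{u}=\boldsymbol{0}$ on $\partial\Omega\times(0,T]$, $\boldsymbol{u}=\boldsymbol{u}_0$ at $t=0$, where $\nabla^{\mathrm{s}}$ is the symmetric gradient. The viscosity $\nu=\nu(\boldsymbol{x},t)$ is given, with $\nu\ge\nu_{\mathrm{min}}>0$ in $\bar Q$ for a constant $\nu_{\mathrm{min}}$, and is such that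 all integrals in the scheme and the estimate are well defined and finite. The data satisfy $\boldsymbol{f}\in[L^2(Q)]^d$ and $\boldsymbol{u}_0\in[H^1_0(\Omega)]^d$ with $\nabla\cdot\boldsymbol{u}_0=0$. The pressure is initialised with $p_0=0$ (and $p_{-1}=0$, corresponding to an initial end-of-step velocity equal to $\boldsymbol{u}_0$). Notation: $t_n=n\tau$, $\nu_n=\nu(\cdot,t_n)$, $\boldsymbol{f}_n=\boldsymbol{f}(\cdot,t_n)\in[L^2(\Omega)]^d$. $\nabla\nu$ is the spatial gradient; $\|\cdot\|_\infty$ is the $L^\infty(\bar Q)$ norm (of the Euclidean length, for vector fields), understood to bound the time-node values, i.e. $|\nabla\nu_n|\le\|\nabla\nu\|_\infty$ a.e. in $\Omega$ for every $n$. $(\cdot,\cdot)$ and $\|\cdot\|$ are the $L^2(\Omega)$ inner product and norm for scalar-, vector- and tensor-valued functions (Euclidean/Frobenius products pointwise). $L^2_0(\Omega)$ is the space of $L^2(\Omega)$ functions with zero mean. $(\nabla\boldsymbol{u})_{ij}=\partial_j u_i$, $\nabla^{\top}\boldsymbol{u}=(\nabla\boldsymbol{u})^{\top}$, so $(\nabla^{\top}\boldsymbol{u}\nabla\nu)_i=\sum_j\partial_i u_j\,\partial_j\nu$ and $((\nabla\boldsymbol{w})\boldsymbol{v})_i=\sum_j v_j\partial_j w_i$. *)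

(* Defs.v *)
From HB Require Import structures.
From mathcomp Require Import all_boot all_order all_algebra.
From mathcomp Require Import all_classical all_reals all_analysis.

Set Implicit Arguments.
Unset Strict Implicit.
Unset Printing Implicit Defensive.

Import Order.TTheory GRing.Theory Num.Theory.
Import numFieldNormedType.Exports.

Local Open Scope classical_set_scope.
Local Open Scope ring_scope.

(* R^d is 'rV[R]_d, with the sigma-algebra generated by the coordinates
   (the Borel sigma-algebra). *)

Definition rV_display : measure_display. Proof. exact: default_measure_display. Qed.

Section measurable_rV.
Context (R : realType) (d : nat).

Let coord : 'I_d -> 'rV[R]_d -> measurableTypeR R := fun i v => v ord0 i.

Let rV_set0 : g_sigma_preimage coord set0.
Proof. exact: sigma_algebra0. Qed.

Let rV_setC A : g_sigma_preimage coord A -> g_sigma_preimage coord (~` A).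
Proof. exact: sigma_algebraC. Qed.

Let rV_bigcup (F : _^nat) : (forall i, g_sigma_preimage coord (F i)) ->
  g_sigma_preimage coord (\bigcup_i (F i)).
Proof. exact: sigma_algebra_bigcup. Qed.

HB.instance Definition _ := @isMeasurable.Build rV_display
  'rV[R]_d (g_sigma_preimage coord) rV_set0 rV_setC rV_bigcup.

End measurable_rV.

Lemma measurable_rVP (R : realType) (d : nat) d1 (T1 : measurableType d1)
    (f : T1 -> 'rV[R]_d) :
  measurable_fun [set: T1] f <->
  forall i, measurable_fun [set: T1] (fun x => f x ord0 i : measurableTypeR R).
Proof.
apply: (@iff_trans _ (g_sigma_preimage
    (fun i => (fun v : 'rV[R]_d => v ord0 i : measurableTypeR R) \o f)
      `<=` measurable)).
  rewrite g_sigma_preimage_comp; split=> [mf A [/= C preC <-]|prefS].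
    exact: mf.
  by move=> _ A mA; apply: prefS; exists A.
split=> [fS i|mf].
- move=> _ A mA.
  apply: fS; apply: sub_sigma_algebra.
  case: d i => [[] []//|d i] in f *.
  rewrite -bigcup_mkord_ord.
  exists i; first exact: ltn_ord.
  by exists A => //; rewrite inord_val.
- apply: smallest_sub; first exact: sigma_algebra_measurable.
  case: d => [|d] in f mf *; first by rewrite big_ord0.
  rewrite -bigcup_mkord_ord; apply: bigcup_sub => i Ii.
  by move=> A [B mB <-]; exact: mf.
Qed.

Section cons_rV.
Context (R : realType) (d : nat).

Definition cons_rV (z : measurableTypeR R * 'rV[R]_d) : 'rV[R]_d.+1 :=
  \row_(i < d.+1) if unlift ord0 i is Some j then z.2 ord0 j else z.1.

Definition uncons_rV (v : 'rV[R]_d.+1) : measurableTypeR R * 'rV[R]_d :=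
  (v ord0 ord0, \row_j v ord0 (lift ord0 j)).

Lemma uncons_rVK : cancel uncons_rV cons_rV.
Proof.
move=> v; apply/rowP => i; rewrite mxE.
by case: unliftP => [j|] -> //=; rewrite mxE.
Qed.

Lemma cons_rVK : cancel cons_rV uncons_rV.
Proof.
move=> [x v]; rewrite /uncons_rV /cons_rV mxE unlift_none /=; congr pair.
by apply/rowP => i; rewrite !mxE liftK.
Qed.

Lemma measurable_rV_coord (i : 'I_d) :
  measurable_fun [set: 'rV[R]_d] (fun v => v ord0 i : measurableTypeR R).
Proof. by have /measurable_rVP := @measurable_id _ 'rV[R]_d setT; exact. Qed.

Lemma measurable_cons_rV : measurable_fun [set: _] cons_rV.
Proof.
apply/measurable_rVP => i.
rewrite (_ : (fun _ => _) = if unlift ord0 i is Some j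
    then (fun z : measurableTypeR R * 'rV[R]_d => z.2 ord0 j : measurableTypeR R)
    else fst); last first.
  by apply/funext => z; rewrite mxE; case: unlift.
case: unliftP => [j _|_]; last exact: measurable_fst.
apply: (measurableT_comp (measurable_rV_coord j)); exact: measurable_snd.
Qed.

End cons_rV.

Lemma measurable_uncons_rV (R : realType) (d : nat) :
  measurable_fun [set: _] (@uncons_rV R d).
Proof.
apply: measurable_fun_pair; first exact: measurable_rV_coord.
apply/measurable_rVP => i.
rewrite (_ : (fun _ => _) =
  fun v : 'rV[R]_d.+1 => v ord0 (lift ord0 i) : measurableTypeR R).
  exact: measurable_rV_coord.
by apply/funext => v; rewrite mxE.
Qed.

(* The product of the one-dimensional Lebesgue measure and m, transported to
   R^(d+1). *)
Section cons_measure.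
Local Open Scope ereal_scope.
Context (R : realType) (d : nat)
  (m : {sigma_finite_measure set 'rV[R]_d -> \bar R}).

Definition cons_measure : set 'rV[R]_d.+1 -> \bar R :=
  pushforward (@lebesgue_measure R \x m) (@cons_rV R d).

Let mcons (A : set 'rV[R]_d.+1) :
  measurable A -> measurable (@cons_rV R d @^-1` A).
Proof. by move=> mA; rewrite -[X in measurable X]setTI; exact: measurable_cons_rV. Qed.

Let cons_measure0 : cons_measure set0 = 0.
Proof. by rewrite /cons_measure /pushforward preimage_set0 measure0. Qed.

Let cons_measure_ge0 A : 0 <= cons_measure A.
Proof. by apply: (measure_ge0 (@lebesgue_measure R \x m)). Qed.

Let cons_measure_sigma_additive : semi_sigma_additive cons_measure.
Proof.
move=> F mF tF mUF; rewrite /cons_measure /pushforward preimage_bigcup.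
apply: measure_semi_sigma_additive.
- by move=> n; exact: mcons.
- apply/trivIsetP => /= i j _ _ ij; rewrite -preimage_setI.
  by move/trivIsetP : tF => /(_ _ _ _ _ ij) ->//; rewrite preimage_set0.
- by rewrite -preimage_bigcup; exact: mcons.
Qed.

HB.instance Definition _ := isMeasure.Build _ _ _ cons_measure
  cons_measure0 cons_measure_ge0 cons_measure_sigma_additive.

Let cons_measure_sigma_finite : sigma_finite setT cons_measure.
Proof.
have /sigma_finiteP[F [TF ndF Foo]] := sigma_finiteT (@lebesgue_measure R).
have /sigma_finiteP[G [TG ndG Goo]] := sigma_finiteT m.
exists (fun n => @uncons_rV R d @^-1` (F n `*` G n)).
  rewrite -preimage_bigcup -[LHS](preimage_setT (@uncons_rV R d)).
  congr (_ @^-1` _); rewrite -setXTT TF TG predeqE => -[x y]; split.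
    move=> [/= [n _ Fnx] [k _ Gky]]; exists (maxn n k) => //; split.
    - by move: x Fnx; exact/subsetPset/ndF/leq_maxl.
    - by move: y Gky; exact/subsetPset/ndG/leq_maxr.
  by move=> [n _ []/= ? ?]; split; exists n.
move=> n; have [? ?] := Foo n; have [? ?] := Goo n; split.
  rewrite -[X in measurable X]setTI; apply: measurable_uncons_rV => //.
  exact: measurableX.
rewrite /cons_measure /pushforward -comp_preimage.
rewrite (_ : _ \o _ = idfun) ?preimage_id; last first.
  by apply/funext => z; exact: cons_rVK.
by rewrite product_measure1E// lte_mul_pinfty// ge0_fin_numE.
Qed.

HB.instance Definition _ := Measure_isSigmaFinite.Build _ _ _ cons_measure
  cons_measure_sigma_finite.

End cons_measure.

(* The Lebesgue measure on R^d; it is pinned down by its value on boxes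
   (lebesgue_rV_box). *)
Fixpoint lebesgue_rV (R : realType) (d : nat) :
    {sigma_finite_measure set 'rV[R]_d -> \bar R} :=
  match d with
  | 0 => \d_(0 : 'rV[R]_0)
  | d'.+1 => cons_measure (lebesgue_rV R d')
  end.

Lemma lebesgue_rV_box (R : realType) (d : nat) (a b : 'I_d -> R) :
  (forall i, a i <= b i) ->
  lebesgue_rV R d [set v | forall i, v ord0 i \in `[a i, b i]] =
  (\prod_(i < d) (b i - a i))%:E.
Proof.
elim: d a b => [|d IHd] a b ab.
  by rewrite big_ord0 /= diracE mem_set//= => -[].
rewrite big_ord_recl /= /cons_measure /pushforward.
rewrite (_ : _ @^-1` _ = `[a ord0, b ord0] `*`
    [set v : 'rV[R]_d | forall i,
      v ord0 i \in `[a (lift ord0 i), b (lift ord0 i)]]); last first.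
  apply/seteqP; split=> [[x v] /= h|[x v] /= [h1 h2] i].
    split; first by have := h ord0; rewrite mxE unlift_none.
    by move=> i; have := h (lift ord0 i); rewrite mxE liftK.
  by rewrite mxE; case: unliftP => [j|] ->.
have mbox : measurable [set v : 'rV[R]_d | forall i,
    v ord0 i \in `[a (lift ord0 i), b (lift ord0 i)]].
  rewrite (_ : [set _ | _] = \big[setI/setT]_(i < d)
    ((fun v : 'rV[R]_d => v ord0 i : measurableTypeR R) @^-1`
      `[a (lift ord0 i), b (lift ord0 i)])); last first.
    rewrite -bigcap_seq; apply/seteqP; split=> [v vab i _|v vab i] /=.
      exact: vab.
    by apply: vab; rewrite /= mem_index_enum.
  apply: bigsetI_measurable => i _; rewrite -[X in measurable X]setTI.
  have := @measurable_rV_coord R d i measurableT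
    `[a (lift ord0 i), b (lift ord0 i)]%classic.
  by apply; exact: measurable_itv.
rewrite product_measure1E//.
rewrite EFinM; congr (_ * _)%E; last by rewrite -IHd.
apply: etrans (lebesgue_measure_itv _) _ => /=.
case: ifPn => //; rewrite lte_fin -leNgt => ba.
by rewrite (@le_anti _ _ (a ord0) (b ord0)) ?subrr// ab ba.
Qed.

Section euclidean.
Context (R : realType).

(* The Euclidean (vectors) and Frobenius (matrices) inner product and length;
   the library norm `|A| on matrices is the max norm. *)
Definition ddot m n (A B : 'M[R]_(m, n)) : R := \sum_i \sum_j A i j * B i j.
Definition elen m n (A : 'M[R]_(m, n)) : R := Num.sqrt (ddot A A).

End euclidean.

Section domains.
Context (R : realType) (d : nat).
Implicit Types (Omega : set 'rV[R]_d).

(* Near each boundary point Omega is the strict epigraph of a Lipschitz function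
   in some Cartesian coordinate system whose last axis points along the unit
   vector e: <x, e> is the last coordinate of x, and x - <x, e> e collects the
   other ones. *)
Definition lipschitz_boundary Omega :=
  forall x0, (closure Omega `\` interior Omega) x0 ->
  exists (e : 'rV[R]_d) (h : 'rV[R]_d -> R) (k : R),
    [/\ elen e = 1, k.-lipschitz_setT h &
        \forall x \near x0,
          Omega x <-> h (x - ddot x e *: e) < ddot x e].

Definition bounded_lipschitz_domain Omega :=
  [/\ open Omega, connected Omega, Omega !=set0, bounded_set Omega &
      lipschitz_boundary Omega].

End domains.

Section sobolev.
Context (R : realType) (d : nat).
Local Notation E := 'rV[R]_d.
Local Notation mu := (lebesgue_rV R d).
Implicit Types (Omega : set E).

Definition partial (i : 'I_d) (f : E -> R) : E -> R :=
  fun x => 'D_(delta_mx ord0 i) f x.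

(* C^oo: every iterated partial derivative is (Frechet) differentiable. *)
Definition smooth (f : E -> R) :=
  forall (s : seq 'I_d) (x : E), differentiable (foldr partial f s) x.

Definition test_function Omega (phi : E -> R) :=
  [/\ smooth phi, compact (closure [set x | phi x != 0]) &
      closure [set x | phi x != 0] `<=` Omega].

Definition L1loc Omega (f : E -> R) :=
  measurable_fun Omega f /\
  forall K, K `<=` Omega -> compact K -> mu.-integrable K (EFin \o f).

Definition weak_gradient Omega (f : E -> R) (g : E -> 'rV[R]_d) :=
  L1loc Omega f /\
  forall i, L1loc Omega (fun x => g x ord0 i) /\
    forall phi, test_function Omega phi ->
      \int[mu]_(x in Omega) (f x * partial i phi x) =
      - \int[mu]_(x in Omega) (g x ord0 i * phi x).

Definition L2 Omega (f : E -> R) :=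
  measurable_fun Omega f /\
  mu.-integrable Omega (fun x => (f x ^+ 2)%:E).

Definition L2mx m n Omega (F : E -> 'M[R]_(m, n)) :=
  forall i j, L2 Omega (fun x => F x i j).

Definition L2dot Omega (f g : E -> R) : R :=
  \int[mu]_(x in Omega) (f x * g x).

Definition L2mxdot m n Omega (F G : E -> 'M[R]_(m, n)) : R :=
  \int[mu]_(x in Omega) ddot (F x) (G x).

Definition L2norm m n Omega (F : E -> 'M[R]_(m, n)) : R :=
  Num.sqrt (L2mxdot Omega F F).

(* Sobolev functions come together with a representative g of their weak
   gradient, which is unique up to a null set. *)
Definition H1 Omega (f : E -> R) (g : E -> 'rV[R]_d) :=
  [/\ L2 Omega f, L2mx Omega g & weak_gradient Omega f g].

(* The closure of the test functions in H^1. *)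
Definition H10 Omega (f : E -> R) (g : E -> 'rV[R]_d) :=
  H1 Omega f g /\
  forall eps : R, 0 < eps -> exists2 phi, test_function Omega phi &
    \int[mu]_(x in Omega) ((f x - phi x) ^+ 2) +
    L2norm Omega (fun x => g x - \row_i partial i phi x) ^+ 2 < eps.

(* [H^1_0]^d, with (Dw)_ij = d_j w_i: row i of Dw is the gradient of w_i. *)
Definition H10v Omega (w : E -> 'rV[R]_d) (Dw : E -> 'M[R]_d) :=
  forall i, H10 Omega (fun x => w x ord0 i) (fun x => row i (Dw x)).

(* L^2_0 \cap H^1 *)
Definition H1mean0 Omega (q : E -> R) (Dq : E -> 'rV[R]_d) :=
  H1 Omega q Dq /\ \int[mu]_(x in Omega) q x = 0.

(* (grad w) v and (grad w)^T v, for row vectors *)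
Definition gradmul (Dw : E -> 'M[R]_d) (v : E -> 'rV[R]_d) : E -> 'rV[R]_d :=
  fun x => v x *m (Dw x)^T.
Definition gradTmul (Dw : E -> 'M[R]_d) (v : E -> 'rV[R]_d) : E -> 'rV[R]_d :=
  fun x => v x *m Dw x.

Definition divergence (Dw : E -> 'M[R]_d) : E -> R := fun x => \tr (Dw x).

End sobolev.

Section spacetime.
Context (R : realType) (d : nat).
Local Notation E := 'rV[R]_d.
Local Notation muT := (lebesgue_rV R d \x @lebesgue_measure R)%E.
Implicit Types (Omega : set E) (F : E -> R -> 'rV[R]_d).

Definition cylinder Omega (T : R) : set (E * measurableTypeR R) :=
  Omega `*` [set t | 0 < t <= T].

Definition closed_cylinder Omega (T : R) : set (E * measurableTypeR R) :=
  closure Omega `*` [set t | 0 <= t <= T].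

Definition L2cyl Omega T F :=
  forall i, measurable_fun (cylinder Omega T) (fun z => F z.1 z.2 ord0 i) /\
    muT.-integrable (cylinder Omega T) (fun z => (F z.1 z.2 ord0 i ^+ 2)%:E).

Definition Linf_norm Omega T F : \bar R :=
  'N[ muT ]_+oo [ (fun z => (elen (F z.1 z.2))%:E) \_ (closed_cylinder Omega T) ]%E.

Definition Linf Omega T F :=
  (forall i, measurable_fun (closed_cylinder Omega T)
     (fun z => F z.1 z.2 ord0 i)) /\
  (Linf_norm Omega T F < +oo)%E.

End spacetime.

(* Main.v *)
Require Import Defs.
From mathcomp Require Import all_boot all_order all_algebra.
From mathcomp Require Import all_classical all_reals all_analysis.
From mathcomp Require Import measurable_realfun ring lra.

Set Implicit Arguments.
Unset Strict Implicit.
Unset Printing Implicit Defensive.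

Import Order.TTheory GRing.Theory Num.Theory.
Import numFieldNormedType.Exports.

Local Open Scope classical_set_scope.
Local Open Scope ring_scope.

(* Test the momentum equation with u_{n+1}. The convective terms cancel by
   skew-symmetry. Write d_n = p_{n+1} - 2 p_n + p_{n-1}. The pressure equation
   tested with 2 p_n - p_{n-1} turns the pressure term into a telescoping part
   plus (tau^2 / 2) |grad d_n|^2, and the difference of two consecutive pressure
   equations tested with d_n gives tau^2 |grad d_n|^2 <= |u_{n+1} - u_n|^2, which
   is absorbed by the dissipation of the implicit Euler step (for n = 0 the
   missing equation is div u_0 = 0). Young's inequality on the right-hand side
   with weights gamma nu_min and eps T, and a discrete Gronwall argument, finish.

   The skew-symmetry is an identity for integrable triple products, hence needs
   H^1_0 to embed in L^4 for d = 2, 3. For test functions this is Ladyzhenskaya's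
   argument: phi^2 is at most the integral of |2 phi d_i phi| along each
   coordinate line. It passes to H^1_0 by Fatou's lemma along an a.e. convergent
   sequence of test functions. *)

(** The term with grad nu is explicit: Young's inequality leaves gamma nu_min |grad u_n|^2 at the
    old time level, which the dissipation of the current step does not control. Hence the energy fed
    to Gronwall contains gamma tau times the viscous dissipation of the latest step, and only the
    share 2 - gamma remains for the sum. That dissipation is weighted with nu at the preceding node,
    so the lower bound nu_min is the only link between the two levels. The constant alpha collects
    the two Young coefficients of |u_{n+1}|^2, namely |grad nu|^2 / (gamma nu_min) and 1 / (eps T).
    Gronwall damps the whole energy, although a step costs only alpha tau |u_{n+1}|^2. The surplus
    alpha tau tau^2 |grad p_{n+1}|^2 is not wasted: it is the pressure sum on the left of the
    estimate. Real integrals of non-integrable functions take a default value, so each splitting of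
    an integral has to be backed by integrability. Bounds are kept for squared norms, which turns
    most limit arguments into polynomial inequalities. *)

(** * Integrable and square-integrable real functions *)

Section square_integrable.
Context d0 (T : measurableType d0) (R : realType)
  (mu : {measure set T -> \bar R}) (D : set T) (mD : measurable D).
Implicit Types f g : T -> R.

Definition Rintegrable f := mu.-integrable D (EFin \o f).

(** Convertible with [L2] when the measure is [lebesgue_rV], so the lemmas of this section apply to
    [L2] as they stand. *)
Definition square_integrable f :=
  measurable_fun D f /\ mu.-integrable D (fun x => (f x ^+ 2)%:E).

Lemma Rintegrable_measurable f : Rintegrable f -> measurable_fun D f.
Proof. by case/integrableP => /measurable_EFinP. Qed.

Lemma Rintegrable_le f g : measurable_fun D f -> Rintegrable g ->
  (forall x, D x -> `|f x| <= g x) -> Rintegrable f.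
Proof.
move=> mf ig fg; apply: le_integrable ig => //; first exact/measurable_EFinP.
move=> x Dx /=; rewrite lee_fin; apply: le_trans (fg _ Dx) _.
by rewrite ler_norm.
Qed.

Lemma RintegrableD f g : Rintegrable f -> Rintegrable g ->
  Rintegrable (fun x => f x + g x).
Proof. exact: integrableD. Qed.

Lemma RintegrableZ (k : R) f : Rintegrable f -> Rintegrable (fun x => k * f x).
Proof. exact: integrableZl. Qed.

Lemma RintegrableN f : Rintegrable f -> Rintegrable (fun x => - f x).
Proof. exact: integrableN. Qed.

Lemma RintegrableB f g : Rintegrable f -> Rintegrable g ->
  Rintegrable (fun x => f x - g x).
Proof. by move=> sf /RintegrableN; exact: RintegrableD. Qed.

Lemma Rintegrable0 : Rintegrable (fun=> 0).
Proof. exact: integrable0. Qed.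

Lemma Rintegrable_sum n (f : 'I_n -> T -> R) : (forall i, Rintegrable (f i)) ->
  Rintegrable (fun x => \sum_i f i x).
Proof.
move=> sf; rewrite (_ : (fun _ => _) = \sum_i f i); last first.
  by apply/funext => x; rewrite fct_sumE.
by elim/big_ind : _ => //; [exact: Rintegrable0|exact: RintegrableD].
Qed.

Lemma eq_Rintegrable f g : (forall x, D x -> f x = g x) ->
  Rintegrable f -> Rintegrable g.
Proof.
by move=> fg; apply: eq_integrable => // x /set_mem Dx /=; rewrite fg.
Qed.

Lemma Rintegral_sum n (f : 'I_n -> T -> R) : (forall i, Rintegrable (f i)) ->
  \int[mu]_(x in D) (\sum_i f i x) = \sum_i \int[mu]_(x in D) f i x.
Proof.
elim: n f => [|n IH] f sf.
  rewrite big_ord0; under eq_Rintegral do rewrite big_ord0.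
  by rewrite /Rintegral integral0.
rewrite big_ord_recl -IH//; under eq_Rintegral do rewrite big_ord_recl.
by rewrite RintegralD//; [exact: sf|exact: (Rintegrable_sum (fun i => sf (lift ord0 i)))].
Qed.

Lemma Rintegrable_fin f : Rintegrable f ->
  (\int[mu]_(x in D) f x)%:E = (\int[mu]_(x in D) (f x)%:E)%E.
Proof. by move=> sf; rewrite fineK// integrable_fin_num. Qed.

Lemma Rintegrable_fing f : measurable_fun D f -> (forall x, D x -> 0 <= f x) ->
  (\int[mu]_(x in D) (f x)%:E < +oo)%E -> Rintegrable f.
Proof.
move=> mf f0 fy; apply/integrableP; split; first exact/measurable_EFinP.
apply: le_lt_trans fy; rewrite le_eqVlt; apply/orP; left; apply/eqP.
by apply: eq_integral => x /set_mem Dx /=; rewrite ger0_norm ?f0.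
Qed.

Lemma ae_le_Rintegral f g : Rintegrable f -> Rintegrable g ->
  {ae mu, forall x, D x -> f x <= g x} ->
  \int[mu]_(x in D) f x <= \int[mu]_(x in D) g x.
Proof.
move=> sf sg fg; rewrite -subr_ge0 -RintegralB//.
have sgf := RintegrableB sg sf.
(* The difference is nonnegative only almost everywhere; its absolute value has the same integral
   and is nonnegative at every point. *)
rewrite (_ : Rintegral _ _ _ = \int[mu]_(x in D) (`|g x - f x|)); last first.
  congr fine; apply: ae_eq_integral => //.
  - by apply/measurable_EFinP; exact: Rintegrable_measurable.
  - apply/measurable_EFinP/measurableT_comp => //; exact: Rintegrable_measurable.
  - by apply: filterS fg => x fg Dx; rewrite ger0_norm// subr_ge0 fg.
exact: Rintegral_ge0.
Qed.

Lemma square_integrableM f g : square_integrable f -> square_integrable g ->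
  Rintegrable (fun x => f x * g x).
Proof.
move=> [mf sf] [mg sg].
apply: (@Rintegrable_le _ (fun x => f x ^+ 2 + g x ^+ 2)) => //.
- exact: measurable_funM.
- exact: RintegrableD.
move=> x _; rewrite normrM -(real_normK (num_real (f x))) -(real_normK (num_real (g x))).
have := sqr_ge0 (`|f x| - `|g x|); have := normr_ge0 (f x).
by have := normr_ge0 (g x); nra.
Qed.

Lemma square_integrableD f g : square_integrable f -> square_integrable g ->
  square_integrable (fun x => f x + g x).
Proof.
move=> hf hg; have := (square_integrableM hf hg); case: hf hg => mf sf [mg sg].
move=> sfg; split; first exact: measurable_funD.
apply: (@eq_Rintegrable (fun x => f x ^+ 2 + g x ^+ 2 + 2 * (f x * g x))).
  by move=> x _; ring.
by apply: RintegrableD; [exact: RintegrableD|exact: RintegrableZ].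
Qed.

Lemma square_integrableZ k f : square_integrable f ->
  square_integrable (fun x => k * f x).
Proof.
move=> [mf sf]; split; first exact: measurable_funM.
apply: (@eq_Rintegrable (fun x => k ^+ 2 * f x ^+ 2)).
  by move=> x _; ring.
exact: RintegrableZ.
Qed.

Lemma square_integrable0 : square_integrable (fun=> 0).
Proof.
by split => //; apply: (@eq_Rintegrable (fun=> 0)) Rintegrable0 => x _; rewrite expr0n.
Qed.

Lemma eq_square_integrable f g : (forall x, D x -> f x = g x) ->
  square_integrable f -> square_integrable g.
Proof.
move=> fg [mf sf]; split.
  by apply: eq_measurable_fun mf => x /set_mem Dx; rewrite fg.
by apply: (@eq_Rintegrable (fun x => f x ^+ 2)) sf => x Dx; rewrite fg.
Qed.

Lemma square_integrableB f g : square_integrable f -> square_integrable g ->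
  square_integrable (fun x => f x - g x).
Proof.
move=> hf /(square_integrableZ (-1)) hg.
apply: eq_square_integrable (square_integrableD hf hg) => x _ /=; ring.
Qed.

Lemma cauchy_schwarz_Rintegral f g : square_integrable f -> square_integrable g ->
  (\int[mu]_(x in D) (f x * g x)) ^+ 2 <=
  (\int[mu]_(x in D) (f x ^+ 2)) * (\int[mu]_(x in D) (g x ^+ 2)).
Proof.
move=> hf hg.
set b := Rintegral _ _ _; set a := Rintegral _ _ _; set c := Rintegral _ _ _.
have sfg : Rintegrable (fun x => f x * g x) by exact: square_integrableM.
have q s t : 0 <= s ^+ 2 * a + 2 * s * t * b + t ^+ 2 * c.
  rewrite -[s ^+ 2 * a]RintegralZl; [|by []|by case: hf].
  rewrite -[2 * s * t * b]RintegralZl//.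
  rewrite -[t ^+ 2 * c]RintegralZl; [|by []|by case: hg].
  have s1 := RintegrableZ (s ^+ 2) hf.2.
  have s2 := RintegrableZ (2 * s * t) sfg.
  have s3 := RintegrableZ (t ^+ 2) hg.2.
  rewrite -RintegralD// -RintegralD//; last exact: RintegrableD.
  apply: Rintegral_ge0 => x _.
  rewrite (_ : _ + _ = (s * f x + t * g x) ^+ 2) ?sqr_ge0//; ring.
have a0 : 0 <= a by apply: Rintegral_ge0 => x _; exact: sqr_ge0.
have c0 : 0 <= c by apply: Rintegral_ge0 => x _; exact: sqr_ge0.
(* The form at (c, -b) equals c (a c - b^2), which settles c > 0; at (b, -a) it settles c = 0 < a;
   at (-b, 1) it settles a = c = 0. *)
have := q b (- a); have := q c (- b); have := q 1 (- b); have := q (-b) 1.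
have [->|c1] := eqVneq c 0.
  have [->|a1] := eqVneq a 0; first by nra.
  have ap : 0 < a by rewrite lt_neqAle eq_sym a1.
  move=> _ _ _; rewrite mulr0 => h.
  rewrite -(ler_pM2l ap) mulr0; lra.
have cp : 0 < c by rewrite lt_neqAle eq_sym c1.
move=> _ _ h _; rewrite -subr_ge0 -(pmulr_rge0 _ cp); lra.
Qed.

End square_integrable.

(** * Borel sets and test functions *)

Section borel_rV.
Context (R : realType) (d : nat).
Local Notation E := 'rV[R]_d.
Local Notation mu := (lebesgue_rV R d).

Lemma measurable_rV_box (A : 'I_d -> set (measurableTypeR R)) :
  (forall i, measurable (A i)) ->
  measurable [set v : E | forall i, A i (v ord0 i)].
Proof.
move=> mA.
rewrite (_ : [set _ | _] = \big[setI/setT]_(i < d)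
    ((fun v : E => v ord0 i : measurableTypeR R) @^-1` A i)); last first.
  rewrite -bigcap_seq; apply/seteqP; split=> [v vab i _|v vab i] /=.
    exact: vab.
  by apply: vab; rewrite /= mem_index_enum.
apply: bigsetI_measurable => i _; rewrite -[X in measurable X]setTI.
exact: (@measurable_rV_coord R d i measurableT).
Qed.

Lemma measurable_rV_ball (x : E) (e : R) : measurable (ball x e).
Proof.
have [e0|e0] := ltP 0 e; last first.
  rewrite (_ : ball x e = set0) ?measurable0//; apply/seteqP; split => // y.
  by move=> [+ _]; rewrite ltNge e0.
rewrite (_ : ball x e =
    [set v : E | forall i, (ball (x ord0 i) e : set (measurableTypeR R)) (v ord0 i)]).
  apply: (@measurable_rV_box (fun i => ball (x ord0 i) e)) => i.
  by apply: (@open_measurable R); exact: ball_open.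
apply/seteqP; split => v /=.
  by move=> [_ h] i; exact: h.
by move=> h; split => // i j; rewrite ord1.
Qed.

(** The sigma-algebra is generated by the coordinates, and balls of the max norm are boxes. An open
    set is the countable union of the balls with rational centre and radius 1/(n+1) that it
    contains. *)
Lemma open_measurable_rV (U : set E) : open U -> measurable U.
Proof.
move=> oU.
pose F (qn : 'rV[rat]_d * nat) : set E :=
  let B := ball (map_mx ratr qn.1 : E) qn.2.+1%:R^-1 in
  if pselect (B `<=` U) then B else set0.
rewrite (_ : U = \bigcup_qn F qn).
  apply: countable_bigcupT_measurable => //.
  by move=> qn; rewrite /F; case: pselect => h /=; [exact: measurable_rV_ball|exact: measurable0].
apply/seteqP; split => [x Ux|x [qn _]]; last first.
  by rewrite /F; case: pselect => // h; exact: h.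
have /nbhs_ballP[e /= e0 eU] : nbhs x U by exact: open_nbhs_nbhs.
(* Half of e, because the small ball is centred at a rational point near x: each of its points is
   within twice the radius of x. *)
have [n] : exists n, n.+1%:R^-1 < e / 2.
  have e2 : 0 < e / 2 by rewrite divr_gt0.
  exact: (filter_ex (near_infty_natSinv_lt (PosNum e2))).
move=> ne.
have n0 : 0 < n.+1%:R^-1 :> R by rewrite invr_gt0.
have qx i : exists q : rat, ball (x ord0 i) (n.+1%:R^-1 : R) (ratr q).
  have [y [h [q _ qy]]] : ball (x ord0 i) (n.+1%:R^-1 : R) `&` (@ratr R @` setT) !=set0.
    apply: dense_rat; last exact: ball_open.
    by exists (x ord0 i); exact: ballxx.
  by exists q; rewrite qy.
have /choice[q hq] := qx.
have xq : ball (map_mx ratr (\row_i q i) : E) n.+1%:R^-1 x.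
  by split => // i j; rewrite ord1 !mxE; apply: ball_sym; exact: hq.
exists (\row_i q i, n) => //; rewrite /F /=; case: pselect => [h/=|hU]; first exact: xq.
exfalso; apply: hU => y hy.
apply: eU; rewrite (splitr e); apply: ball_triangle (ball_sym _) _.
  exact: (le_ball (ltW ne) xq).
exact: (le_ball (ltW ne) hy).
Qed.

Lemma continuous_measurable_rV (f : E -> R) (D : set E) :
  continuous f -> measurable D -> measurable_fun D f.
Proof.
move=> cf mD; apply: (measurable_funS measurableT) => //.
apply: (measurability _ (RGenOInfty.measurableE R)) => //.
move=> _ [_ [a ->] <-]; rewrite setTI; apply: open_measurable_rV.
by move/continuousP : cf; apply; exact: rray_open.
Qed.

Lemma ler_coord_normr (x : E) (i : 'I_d) : `|x ord0 i| <= `|x|.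
Proof.
have /mapP[j Hj ->] : `|x ord0 i| \in [seq `|x y.1 y.2| | y : 'I_1 * 'I_d].
  by apply/mapP; exists (ord0, i) => //=; rewrite mem_enum.
by rewrite [leRHS]/Num.norm /= mx_normrE; apply/bigmax_geP; right => /=; exists j.
Qed.

Lemma bounded_set_lebesgue_rV (Omega : set E) : bounded_set Omega ->
  measurable Omega -> (mu Omega < +oo)%E.
Proof.
move=> [M [_ hM]] mO.
have {}hM x : Omega x -> `|x| <= M + 1 by apply: hM; rewrite ltrDl.
pose B := [set v : E | forall i, v ord0 i \in `[- (`|M| + 1), `|M| + 1]].
have mB : measurable B.
  by apply: (@measurable_rV_box (fun i => [set` `[- (`|M| + 1), `|M| + 1]])) => i;
     exact: measurable_itv.
have h : mu B = (\prod_(i < d) ((`|M| + 1) - - (`|M| + 1)))%:E.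
  apply: lebesgue_rV_box => _; apply: (@le_trans _ _ 0); last by rewrite addr_ge0.
  by rewrite oppr_le0 addr_ge0.
apply: (@le_lt_trans _ _ (mu B)).
  apply: le_measure; rewrite ?inE// => x Ox i; rewrite in_itv /= -ler_norml.
  apply: (@le_trans _ _ `|x|); last first.
    by apply: le_trans (hM _ Ox) _; rewrite lerD2r ler_norm.
  exact: ler_coord_normr.
by rewrite h ltry.
Qed.

End borel_rV.

(** * Algebra and integrability of test functions *)

Section test_functions.
Context (R : realType) (d : nat).
Local Notation E := 'rV[R]_d.
Local Notation mu := (lebesgue_rV R d).
Implicit Types (f g phi psi : E -> R) (i : 'I_d).

Lemma partialD f g k i : (forall x, differentiable f x) ->
  (forall x, differentiable g x) ->
  partial i (fun x => f x + k * g x) =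
  fun x => partial i f x + k * partial i g x.
Proof.
move=> df dg; apply/funext => x; rewrite /partial.
have h1 := @diff_derivable _ _ _ _ _ (delta_mx ord0 i) (df x).
have h2 := @diff_derivable _ _ _ _ _ (delta_mx ord0 i) (dg x).
by rewrite (@deriveD _ _ _ f (k \*: g)) ?deriveZ//; exact: derivableZ.
Qed.

(** The factor [1] gives the product rule the shape f + k g, so that [differentiable_uptoD] applies
    to the result. *)
Lemma partialM f g i : (forall x, differentiable f x) ->
  (forall x, differentiable g x) ->
  partial i (fun x => f x * g x) =
  fun x => f x * partial i g x + 1 * (g x * partial i f x).
Proof.
move=> df dg; apply/funext => x; rewrite /partial mul1r.
have h1 := @diff_derivable _ _ _ _ _ (delta_mx ord0 i) (df x).
have h2 := @diff_derivable _ _ _ _ _ (delta_mx ord0 i) (dg x).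
by rewrite (@deriveM _ _ f g).
Qed.

Lemma partial_notin_supp f i x :
  ~ closure [set x | f x != 0] x -> partial i f x = 0.
Proof.
move=> nx; rewrite /partial (@near_eq_derive _ _ _ f (cst 0)) ?derive_cst//.
have : nbhs x (~` closure [set x | f x != 0]).
  by apply: open_nbhs_nbhs; split => //; exact/closed_openC/closed_closure.
apply: filterS => y /= ny; apply/eqP/negPn/negP => fy; apply: ny.
exact: subset_closure.
Qed.

(** Smoothness graded by order. A partial derivative of a product is a sum of products, one order
    lower, so closure under products is an induction on n, which [smooth] alone does not offer. *)
Definition differentiable_upto n f := forall s : seq 'I_d, (size s <= n)%N ->
  forall x, differentiable (foldr (@partial R d) f s) x.

Lemma differentiable_uptoS n f : differentiable_upto n.+1 f <->
  (forall x, differentiable f x) /\ forall i, differentiable_upto n (partial i f).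
Proof.
split=> [h|[h1 h2] s].
  split; first exact: (h [::]).
  by move=> i s sn x; have := h (rcons s i); rewrite foldr_rcons size_rcons; exact.
case/lastP: s => [//|s i]; rewrite size_rcons ltnS foldr_rcons => sn.
exact: h2.
Qed.

Lemma differentiable_uptoW m n f : (m <= n)%N ->
  differentiable_upto n f -> differentiable_upto m f.
Proof. by move=> mn h s sm; apply: h; exact: leq_trans mn. Qed.

Lemma differentiable_uptoD n f g k : differentiable_upto n f ->
  differentiable_upto n g -> differentiable_upto n (fun x => f x + k * g x).
Proof.
elim: n f g => [|n IH] f g.
  move=> hf hg [|//] _ x /=.
  apply: (@differentiableD _ _ _ f (k \*: g)); first exact: (hf [::]).
  by apply: differentiableZ; exact: (hg [::]).
move=> /differentiable_uptoS[f0 f1] /differentiable_uptoS[g0 g1].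
apply/differentiable_uptoS; split.
  move=> x; apply: (@differentiableD _ _ _ f (k \*: g)) => //.
  exact: differentiableZ.
by move=> i; rewrite partialD//; exact: IH.
Qed.

Lemma differentiable_uptoM n f g : differentiable_upto n f ->
  differentiable_upto n g -> differentiable_upto n (fun x => f x * g x).
Proof.
elim: n f g => [|n IH] f g hf hg.
  by move=> [|//] _ x; apply: (@differentiableM _ _ f g);
    [exact: (hf [::])|exact: (hg [::])].
have [f0 f1] := (differentiable_uptoS _ _).1 hf.
have [g0 g1] := (differentiable_uptoS _ _).1 hg.
apply/differentiable_uptoS; split; first by move=> x; exact: differentiableM.
move=> i; rewrite partialM//; apply: differentiable_uptoD; apply: IH => //.
  exact: differentiable_uptoW hf.
exact: differentiable_uptoW hg.
Qed.

Lemma smoothP f : smooth f <-> forall n, differentiable_upto n f.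
Proof. by split=> [h n s _ x|h s x]; [exact: h|exact: (h (size s))]. Qed.

Lemma smooth_partial f i : smooth f -> smooth (partial i f).
Proof. by move=> sf s x; rewrite -foldr_rcons; exact: sf. Qed.

Lemma smooth_differentiable f : smooth f -> forall x, differentiable f x.
Proof. by move=> sf; exact: (sf [::]). Qed.

Lemma smooth_continuous f : smooth f -> continuous f.
Proof. by move=> sf x; exact/differentiable_continuous/smooth_differentiable. Qed.

Lemma smoothD f g k : smooth f -> smooth g -> smooth (fun x => f x + k * g x).
Proof. by move=> /smoothP hf /smoothP hg; apply/smoothP => n; exact: differentiable_uptoD. Qed.

Lemma smoothM f g : smooth f -> smooth g -> smooth (fun x => f x * g x).
Proof. by move=> /smoothP hf /smoothP hg; apply/smoothP => n; exact: differentiable_uptoM. Qed.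

Variable Omega : set E.
Hypothesis oOmega : open Omega.
Hypothesis bOmega : bounded_set Omega.

Let mOmega : measurable Omega. Proof. exact: open_measurable_rV. Qed.

Lemma test_functionD phi psi k : test_function Omega phi ->
  test_function Omega psi -> test_function Omega (fun x => phi x + k * psi x).
Proof.
move=> [s1 c1 o1] [s2 c2 o2].
have sub : closure [set x | phi x + k * psi x != 0] `<=`
    closure [set x | phi x != 0] `|` closure [set x | psi x != 0].
  rewrite -closureU; apply: closureS => x /=; apply: contraNP => /not_orP[].
  by move=> /negP/negPn/eqP -> /negP/negPn/eqP ->; rewrite mulr0 addr0.
split; first exact: smoothD.
- apply: (subclosed_compact _ _ sub); first exact: closed_closure.
  exact: compactU.
- by move=> x /sub [/o1|/o2].
Qed.

Lemma test_functionB phi psi : test_function Omega phi ->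
  test_function Omega psi -> test_function Omega (fun x => phi x - psi x).
Proof.
move=> h1 h2; rewrite (_ : (fun x => _) = fun x => phi x + (-1) * psi x).
  exact: test_functionD.
by apply/funext => x; rewrite mulN1r.
Qed.

Lemma test_functionM phi psi : test_function Omega phi ->
  test_function Omega psi -> test_function Omega (fun x => phi x * psi x).
Proof.
move=> [s1 c1 o1] [s2 c2 o2].
have sub : closure [set x | phi x * psi x != 0] `<=` closure [set x | phi x != 0].
  apply: closureS => x /=; apply: contra => /eqP ->; by rewrite mul0r.
split; first exact: smoothM.
- by apply: (subclosed_compact _ _ sub) => //; exact: closed_closure.
- exact: subset_trans o1.
Qed.

Lemma test_function_notin phi x : test_function Omega phi -> ~ Omega x -> phi x = 0.
Proof.
move=> [_ _ sub] nx; apply/eqP/negPn/negP => h; apply: nx; apply: sub.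
exact: subset_closure.
Qed.

Lemma test_function_partial_notin phi i x :
  test_function Omega phi -> ~ Omega x -> partial i phi x = 0.
Proof. by move=> [_ _ sub] nx; apply: partial_notin_supp => /sub. Qed.

Lemma test_functionP phi i : test_function Omega phi ->
  test_function Omega (partial i phi).
Proof.
move=> [s c o]; have sub : closure [set x | partial i phi x != 0] `<=`
    closure [set x | phi x != 0].
  apply: (@subset_trans _ (closure (closure [set x | phi x != 0]))); last first.
    by have /closure_id <- := @closed_closure _ [set x | phi x != 0].
  apply: closureS => x /=; apply: contraNP => h.
  by rewrite partial_notin_supp.
split; first exact: smooth_partial.
  by apply: (subclosed_compact _ _ sub) => //; exact: closed_closure.
exact: subset_trans o.
Qed.

Lemma test_function_bounded phi : test_function Omega phi ->
  exists M, forall x, `|phi x| <= M.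
Proof.
move=> [s c o].
have /compact_bounded[M [_ hM]] : compact (phi @` closure [set x | phi x != 0]).
  by apply: continuous_compact c; apply: continuous_subspaceT; exact: smooth_continuous.
exists (`|M| + 1) => x; have [->|h] := eqVneq (phi x) 0.
  by rewrite normr0 addr_ge0.
apply: hM; first by rewrite (le_lt_trans (ler_norm M))// ltrDl.
by exists x => //; exact: subset_closure.
Qed.

Lemma test_function_measurable phi (D : set E) : test_function Omega phi ->
  measurable D -> measurable_fun D phi.
Proof. by move=> [/smooth_continuous s _ _]; exact: continuous_measurable_rV. Qed.

Lemma test_function_Rintegrable phi : test_function Omega phi ->
  Rintegrable mu Omega phi.
Proof.
move=> h; apply: measurable_bounded_integrable => //.
- exact: bounded_set_lebesgue_rV.
- exact: test_function_measurable.
have [M hM] := test_function_bounded h.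
by exists M; split; [exact: num_real|] => K MK x _ /=; rewrite (le_trans (hM x))// ltW.
Qed.

Lemma test_function_L2 phi : test_function Omega phi -> L2 Omega phi.
Proof.
move=> h; split; first exact: test_function_measurable.
apply: (@test_function_Rintegrable (fun x => phi x ^+ 2)).
exact: test_functionM.
Qed.

End test_functions.

(** * Ladyzhenskaya's inequality *)

Section lebesgue_rV_tonelli.
Local Open Scope ereal_scope.
Context (R : realType).
Local Notation leb := (@lebesgue_measure R).

(** Hölder with both exponents 2. The integrals may be infinite, so it can be used on slices before
    any finiteness is known. *)
Lemma cauchy_schwarz_ereal d0 (T : measurableType d0)
    (mu : {measure set T -> \bar R}) (f g : T -> R) :
  measurable_fun [set: T] f -> measurable_fun [set: T] g ->
  \int[mu]_x (`|f x * g x|)%:E <=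
  (\int[mu]_x (f x ^+ 2)%:E) `^ 2^-1 * (\int[mu]_x (g x ^+ 2)%:E) `^ 2^-1.
Proof.
move=> mf mg; have h2 : (2^-1 + 2^-1 = 1 :> R)%R by lra.
have /= := hoelder mu mf mg (ltr0Sn R 1) (ltr0Sn R 1) h2.
rewrite Lnorm1.
have n2 (k : T -> R) : 'N[mu]_2%:E[EFin \o k] = (\int[mu]_x (k x ^+ 2)%:E) `^ 2^-1.
  rewrite unlock /=; congr (_ `^ _); apply: eq_integral => x _ /=.
  by rewrite powR_mulrn// real_normK ?num_real.
by rewrite !n2.
Qed.

Lemma integral_lebesgue_rV_consl d (F : 'rV[R]_d.+1 -> \bar R) :
  measurable_fun [set: _] F -> (forall w, 0 <= F w) ->
  \int[lebesgue_rV R d.+1]_w F w =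
  \int[leb]_x \int[lebesgue_rV R d]_v F (cons_rV (x, v)).
Proof.
move=> mF F0.
rewrite -[LHS]/(\int[pushforward (leb \x lebesgue_rV R d) (@cons_rV R d)]_w F w).
rewrite ge0_integral_pushforward//; last exact: measurable_cons_rV.
rewrite preimage_setT fubini_tonelli1//.
  by apply: measurableT_comp mF _; exact: measurable_cons_rV.
by move=> z; exact: F0.
Qed.

(** Here the integral along the first coordinate is the inner one, which is where a bound along
    lines in that direction can be inserted. *)
Lemma integral_lebesgue_rV_consr d (F : 'rV[R]_d.+1 -> \bar R) :
  measurable_fun [set: _] F -> (forall w, 0 <= F w) ->
  \int[lebesgue_rV R d.+1]_w F w =
  \int[lebesgue_rV R d]_v \int[leb]_x F (cons_rV (x, v)).
Proof.
move=> mF F0; rewrite integral_lebesgue_rV_consl//.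
rewrite (@fubini_tonelli _ _ _ _ _ leb (lebesgue_rV R d) (F \o @cons_rV R d))//.
  by apply: measurableT_comp mF _; exact: measurable_cons_rV.
by move=> z; exact: F0.
Qed.

Definition rV2 (y z : R) : 'rV[R]_2 := cons_rV (y, cons_rV (z, (0%R : 'rV[R]_0))).

Lemma measurable_rV2 : measurable_fun [set: _]
  (fun yz : measurableTypeR R * measurableTypeR R => rV2 yz.1 yz.2).
Proof.
apply: (measurableT_comp (@measurable_cons_rV R 1)).
apply: measurable_fun_pair => //.
apply: (measurableT_comp (@measurable_cons_rV R 0)).
exact: measurable_fun_pair.
Qed.

Lemma integral_lebesgue_rV2 (F : 'rV[R]_2 -> \bar R) :
  measurable_fun [set: _] F -> (forall w, 0 <= F w) ->
  \int[lebesgue_rV R 2]_w F w = \int[leb]_y \int[leb]_z F (rV2 y z).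
Proof.
move=> mF F0; rewrite integral_lebesgue_rV_consl//.
have mc y : measurable_fun [set: _] (fun v : 'rV[R]_1 => F (cons_rV (y, v))).
  apply: measurableT_comp mF _; apply: (measurableT_comp (@measurable_cons_rV R 1)).
  exact: measurable_fun_pair.
apply: eq_integral => y _; rewrite integral_lebesgue_rV_consl//.
apply: eq_integral => z _; rewrite /= integral_dirac//.
  by rewrite diracE in_setT mul1e.
apply: measurableT_comp (mc y) _; apply: (measurableT_comp (@measurable_cons_rV R 0)).
exact: measurable_fun_pair.
Qed.

End lebesgue_rV_tonelli.

(** * Gagliardo-type bounds on lines and in the plane *)

Section gagliardo.
Context (R : realType).
Local Notation leb := (@lebesgue_measure R).

(** The fundamental theorem of calculus for g^2, whose derivative is 2 g g', from a point where g
    vanishes up to s; the integral is then enlarged to the whole line. *)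
Lemma sqr_le_integral_line (g : R -> R) (s : R) :
  (forall t, derivable g t 1) -> continuous (g^`())%classic ->
  (exists a, forall t, t <= a -> g t = 0) ->
  ((g s ^+ 2)%:E <= \int[leb]_t (`|2 * g t * (g^`())%classic t|)%:E)%E.
Proof.
move=> dg cdg [a0 ga].
(* The minimum with s - 1 secures a < s, as the fundamental theorem requires. *)
pose a := Num.min a0 (s - 1).
have ga0 : g a = 0 by apply: ga; rewrite ge_min lexx.
have as_ : a < s by rewrite gt_min orbC ltrBlDr ltrDl ltr01.
pose h t := 2 * g t * (g^`())%classic t.
have cg : continuous g.
  by move=> t; apply: differentiable_continuous; exact/derivable1_diffP.
have ch : continuous h.
  move=> t; apply: cvgM; last exact: cdg.
  by apply: cvgM; [exact: cvg_cst|exact: cg].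
have mh : measurable_fun [set: R] h by exact: continuous_measurable_fun.
have dG t : derivable (g * g) t 1 by exact: derivableM.
have cG : continuous (g * g).
  by move=> t; apply: cvgM; exact: cg.
have Ga : (g * g) a = 0 by change (g a * g a = 0); rewrite ga0 mulr0.
have Gs : (g * g) s = g s ^+ 2 by rewrite expr2.
have := @continuous_FTC2 R h (g * g) a s as_; rewrite Ga Gs sube0.
move=> <-; last 3 first.
- exact: continuous_subspaceT.
- split=> [t _| |].
  + exact: dG.
  + by apply: cvg_at_right_filter; exact: cG.
  + by apply: cvg_at_left_filter; exact: cG.
- move=> t _; rewrite /h !derive1E deriveM// -mulrA.
  by rewrite [RHS]mulr_natl mulr2n.
apply: le_trans (lee_abs _) _.
apply: le_trans (le_abse_integral _ _ _) _ => //.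
  by apply/measurable_EFinP; exact: measurable_funS mh.
apply: ge0_subset_integral => //.
by apply/measurable_EFinP; exact: measurableT_comp.
Qed.

Local Open Scope ereal_scope.

(** The bound by integrals along the first axis depends on z only, the one along the second axis on
    y only. Their product dominates p^2, has separated variables, and integrates to the product of
    the two plane integrals. *)
Lemma integral_sqr_le_rV2 (p a0 a1 : 'rV[R]_2 -> R) :
  measurable_fun [set: _] p -> measurable_fun [set: _] a0 ->
  measurable_fun [set: _] a1 ->
  (forall w, (0 <= p w)%R) -> (forall w, (0 <= a0 w)%R) ->
  (forall w, (0 <= a1 w)%R) ->
  (forall y z, (p (rV2 y z))%:E <= \int[leb]_s (a0 (rV2 s z))%:E) ->
  (forall y z, (p (rV2 y z))%:E <= \int[leb]_s (a1 (rV2 y s))%:E) ->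
  \int[lebesgue_rV R 2]_w (p w ^+ 2)%:E <=
  (\int[lebesgue_rV R 2]_w (a0 w)%:E) * (\int[lebesgue_rV R 2]_w (a1 w)%:E).
Proof.
move=> mp ma0 ma1 p0 a00 a10 pa0 pa1.
have m2 (q : 'rV[R]_2 -> R) : measurable_fun [set: _] q ->
    measurable_fun [set: _] (fun yz : measurableTypeR R * measurableTypeR R =>
      (q (rV2 yz.1 yz.2))%:E).
  move=> mq; apply/measurable_EFinP; apply: measurableT_comp mq _.
  exact: measurable_rV2.
rewrite !integral_lebesgue_rV2//; try exact/measurable_EFinP;
  try exact/measurable_EFinP/measurable_funX;
  try by move=> w; rewrite lee_fin// sqr_ge0.
pose A0 z := \int[leb]_s (a0 (rV2 s z))%:E.
pose A1 y := \int[leb]_s (a1 (rV2 y s))%:E.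
have A00 z : 0 <= A0 z by apply: integral_ge0 => s _; rewrite lee_fin.
have A10 z : 0 <= A1 z by apply: integral_ge0 => s _; rewrite lee_fin.
have mA0 : measurable_fun [set: R] A0.
  apply: (@measurable_fun_fubini_tonelli_G _ _ _ _ _ leb _ (m2 _ ma0)).
  by move=> z; rewrite lee_fin.
have mA1 : measurable_fun [set: R] A1.
  apply: (@measurable_fun_fubini_tonelli_F _ _ _ _ _ leb _ (m2 _ ma1)).
  by move=> z; rewrite lee_fin.
rewrite (@fubini_tonelli _ _ _ _ _ leb leb _ (m2 _ ma0)) /=; last by move=> z; rewrite lee_fin.
rewrite -/A0 -/A1.
have mp2 : measurable_fun [set: _] (fun w => p w ^+ 2)%R by exact: measurable_funX.
have mP : measurable_fun [set: R] (fun y => \int[leb]_z (p (rV2 y z) ^+ 2)%:E).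
  apply: (@measurable_fun_fubini_tonelli_F _ _ _ _ _ leb _ (m2 _ mp2)).
  by move=> z; rewrite lee_fin sqr_ge0.
apply: (@le_trans _ _ (\int[leb]_y ((\int[leb]_z A0 z) * A1 y))); last first.
  rewrite ge0_integralZl//; exact: integral_ge0.
apply: ge0_le_integral => //.
- by move=> y _; apply: integral_ge0 => z _; rewrite lee_fin sqr_ge0.
- exact: emeasurable_funM.
move=> y _; rewrite -ge0_integralZr//.
apply: ge0_le_integral => //.
- by move=> z _; rewrite lee_fin sqr_ge0.
- exact: (measurableT_comp (m2 _ mp2) (pair1_measurable y)).
- exact: emeasurable_funM.
by move=> z _; rewrite expr2 EFinM; apply: lee_pmul; rewrite ?lee_fin.
Qed.

End gagliardo.

(** * The L^4 bound for test functions in dimensions two and three *)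

Section ladyzhenskaya.
Context (R : realType).
Local Notation leb := (@lebesgue_measure R).

Section line.
Context (d : nat) (Omega : set 'rV[R]_d) (phi : 'rV[R]_d -> R) (i : 'I_d).
Hypothesis tphi : test_function Omega phi.

Lemma derive_line (w : 'rV[R]_d) (t : R) :
  let g := fun s => phi (w + s *: delta_mx ord0 i) in
  derivable g t 1 /\ (g^`())%classic t = partial i phi (w + t *: delta_mx ord0 i).
Proof.
move=> g; set a := w + t *: delta_mx ord0 i.
have E : (fun h : R => h^-1 *: ((g \o shift t) (h *: 1) - g t)) =
    (fun h : R => h^-1 *: ((phi \o shift a) (h *: delta_mx ord0 i) - phi a)).
  apply/funext => h /=; rewrite /g /a; congr (_ *: (phi _ - _)).
  by rewrite scalerDl [_ *: 1]mulr1 addrCA.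
have da : derivable phi a (delta_mx ord0 i).
  by apply: diff_derivable; apply: smooth_differentiable; case: tphi.
split; first by rewrite /derivable E.
by rewrite derive1E /derive E.
Qed.

(** The hypothesis on [c] describes a line parallel to axis i coordinate by coordinate, the form
    that can be checked on points built with [cons_rV] and [rV2]. *)
Lemma test_function_line (c : R -> 'rV[R]_d) (s : R) :
  (forall t j, c t ord0 j = if j == i then t else c 0 ord0 j) ->
  ((phi (c s) ^+ 2)%:E <=
   \int[leb]_t (`|2 * phi (c t) * partial i phi (c t)|)%:E)%E.
Proof.
move=> cE.
have c0 t : c t = c 0 + t *: delta_mx ord0 i.
  apply/rowP => j; rewrite !mxE cE [in X in _ = X + _]cE eqxx andTb.
  by case: eqP => _; rewrite ?mulr1 ?mulr0 ?addr0 ?add0r.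
pose g t := phi (c 0 + t *: delta_mx ord0 i).
have gE t : phi (c t) = g t by rewrite /g -c0.
have g'E t : partial i phi (c t) = (g^`())%classic t.
  by rewrite c0; have [_ ->] := derive_line (c 0) t.
rewrite gE; under eq_integral do rewrite gE g'E.
apply: sqr_le_integral_line.
- by move=> t; have [] := derive_line (c 0) t.
- have -> : (g^`())%classic = partial i phi \o c by apply/funext => t /=; rewrite g'E.
  move=> t; apply: continuous_comp; last first.
    by apply: smooth_continuous; apply: smooth_partial; case: tphi.
  have -> : c = fun t => c 0 + t *: delta_mx ord0 i by exact/funext.
  by apply: cvgD; [exact: cvg_cst|apply: cvgZr_tmp; exact: cvg_id].
case: tphi => _ /compact_bounded[M [_ hM]] _.
(* Beyond this point the i-th coordinate alone exceeds |M| + 1 in size, hence [c t] lies outside the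
   support of phi. *)
exists (- (`|M| + 2)) => t tM; rewrite -gE; apply/eqP/negPn/negP => h.
have /hM : M < `|M| + 1 by rewrite (le_lt_trans (ler_norm M))// ltrDl.
have cl : closure [set x | phi x != 0] (c t) by exact: subset_closure.
move=> /(_ (c t) cl) /(le_trans (ler_coord_normr _ i)).
rewrite cE eqxx; apply/negP; rewrite -ltNge (@ltr0_norm _ t); first by lra.
by rewrite (le_lt_trans tM)// oppr_lt0 ltr_wpDl.
Qed.

End line.

(** The integrand of the squared H^1 norm. It dominates both |2 f d_i f| and (d_i f)^2, so one
    density serves for the lines in every direction. *)
Definition H1density d (f : 'rV[R]_d -> R) (g : 'rV[R]_d -> 'rV[R]_d) x : R :=
  f x ^+ 2 + ddot (g x) (g x).

Definition gradient d (f : 'rV[R]_d -> R) : 'rV[R]_d -> 'rV[R]_d :=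
  fun x => \row_i partial i f x.

Lemma ddot_row d (a b : 'rV[R]_d) : ddot a b = \sum_i a ord0 i * b ord0 i.
Proof. by rewrite /ddot big_ord_recl big_ord0 addr0. Qed.

Lemma sqr_coord_le_ddot d (a : 'rV[R]_d) i : a ord0 i ^+ 2 <= ddot a a.
Proof.
by rewrite ddot_row (bigD1 i)//= expr2 lerDl sumr_ge0// => j _; rewrite -expr2 sqr_ge0.
Qed.

Lemma ddot_ge0 m n (a : 'M[R]_(m, n)) : 0 <= ddot a a.
Proof.
by apply: sumr_ge0 => i _; apply: sumr_ge0 => j _; rewrite -expr2 sqr_ge0.
Qed.

Lemma H1density_ge0 d (f : 'rV[R]_d -> R) g x : 0 <= H1density f g x.
Proof. by rewrite addr_ge0 ?sqr_ge0// ddot_ge0. Qed.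

Lemma sqr_partial_le_H1density d (f : 'rV[R]_d -> R) i x :
  partial i f x ^+ 2 <= H1density f (gradient f) x.
Proof.
have := sqr_coord_le_ddot (gradient f x) i; rewrite mxE /H1density.
by have := sqr_ge0 (f x); lra.
Qed.

Lemma line_density_le d (f : 'rV[R]_d -> R) i x :
  `|2 * f x * partial i f x| <= H1density f (gradient f) x.
Proof.
have := sqr_coord_le_ddot (gradient f x) i; rewrite mxE /H1density => h.
have := sqr_ge0 (f x - partial i f x); have := sqr_ge0 (f x + partial i f x).
by rewrite ler_norml => h1 h2; apply/andP; split; nra.
Qed.

Lemma test_function_H1density_measurable d Omega (phi : 'rV[R]_d -> R) :
  test_function Omega phi ->
  measurable_fun [set: _] (H1density phi (gradient phi)).
Proof.
move=> tphi; apply: measurable_funD.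
  by apply: measurable_funX; exact: test_function_measurable tphi _.
rewrite (_ : (fun _ => _) = fun x => \sum_i (partial i phi x * partial i phi x)).
  apply: measurable_sum => i; apply: measurable_funM;
    exact: test_function_measurable (test_functionP i tphi) _.
by apply/funext => x; rewrite ddot_row; apply: eq_bigr => i _; rewrite !mxE.
Qed.

Local Open Scope ereal_scope.

Lemma test_function_line_H1density d Omega (phi : 'rV[R]_d -> R) i
    (c : R -> 'rV[R]_d) s : test_function Omega phi ->
  (forall t j, c t ord0 j = if j == i then t else c 0%R ord0 j) ->
  measurable_fun [set: R] c ->
  (phi (c s) ^+ 2)%:E <= \int[leb]_t (H1density phi (gradient phi) (c t))%:E.
Proof.
move=> tphi cE mc; apply: le_trans (test_function_line tphi s cE) _.
have mphi := test_function_measurable tphi measurableT.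
have mp := test_function_measurable (test_functionP i tphi) measurableT.
apply: ge0_le_integral => //.
- apply/measurable_EFinP/measurableT_comp => //; apply: measurable_funM.
    by apply: measurable_funM => //; exact: measurableT_comp mphi mc.
  exact: measurableT_comp mp mc.
- apply/measurable_EFinP; apply: measurableT_comp mc.
  exact: test_function_H1density_measurable tphi.
- by move=> t _; rewrite lee_fin line_density_le.
Qed.

Lemma test_function_L4_rV2 Omega (phi : 'rV[R]_2 -> R) :
  test_function Omega phi ->
  \int[lebesgue_rV R 2]_w (phi w ^+ 4)%:E <=
  (\int[lebesgue_rV R 2]_w (H1density phi (gradient phi) w)%:E) *
  (\int[lebesgue_rV R 2]_w (H1density phi (gradient phi) w)%:E).
Proof.
move=> tphi.
have mphi := test_function_measurable tphi measurableT.
have mH := test_function_H1density_measurable tphi.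
have := @integral_sqr_le_rV2 R (fun w => phi w ^+ 2)%R
  (H1density phi (gradient phi)) (H1density phi (gradient phi)).
under eq_integral do rewrite -exprM.
apply => //.
- exact: measurable_funX.
- by move=> w; exact: sqr_ge0.
- by move=> w; exact: H1density_ge0.
- by move=> w; exact: H1density_ge0.
- move=> y z; apply: (@test_function_line_H1density _ _ _ ord0 (fun s => rV2 s z) y tphi).
    move=> t j; rewrite /rV2 !mxE; case: unliftP => [k|] ->; rewrite ?eqxx//=.
  exact: (measurableT_comp (@measurable_rV2 R) (pair2_measurable z)).
- move=> y z; apply: (@test_function_line_H1density _ _ _ (lift ord0 ord0) (fun s => rV2 y s) z tphi).
    move=> t j; rewrite /rV2 !mxE; case: unliftP => [k|] ->//=.
    by rewrite !mxE; case: unliftP => [[]//|] ->; rewrite eqxx.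
  exact: (measurableT_comp (@measurable_rV2 R) (pair1_measurable y)).
Qed.


Lemma poweR_half_sqr (x : \bar R) : 0 <= x -> x `^ 2^-1 * x `^ 2^-1 = x.
Proof.
move=> x0; have h : (2^-1 + 2^-1 = 1 :> R)%R by lra.
by rewrite -poweRD ?h ?poweRe1// poweRD_defE h oner_eq0.
Qed.

(* On each slice x_0 = x the planar bound and Cauchy-Schwarz give
   int phi^4 <= 4 (int phi^2) (int |grad phi|^2), and the slice integral of phi^2
   is at most N by the line bound in the direction x_0. *)
Lemma test_function_L4_rV3 Omega (phi : 'rV[R]_3 -> R) :
  test_function Omega phi ->
  \int[lebesgue_rV R 3]_w (phi w ^+ 4)%:E <=
  4%:E * ((\int[lebesgue_rV R 3]_w (H1density phi (gradient phi) w)%:E) *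
  (\int[lebesgue_rV R 3]_w (H1density phi (gradient phi) w)%:E)).
Proof.
move=> tphi.
set q := H1density phi (gradient phi); set N := \int[_]_w (q w)%:E.
have mphi := test_function_measurable tphi measurableT.
have mp i := test_function_measurable (test_functionP i tphi) measurableT.
have mq : measurable_fun [set: _] q := test_function_H1density_measurable tphi.
have q0 w : 0 <= (q w)%:E by rewrite lee_fin H1density_ge0.
have mc := @measurable_cons_rV R 2.
have mcx x := measurableT_comp mc (pair1_measurable x).
pose B x := \int[lebesgue_rV R 2]_v (q (cons_rV (x, v)))%:E.
have B0 x : 0 <= B x by exact: integral_ge0.
have N0 : 0 <= N by exact: integral_ge0.
have mB : measurable_fun [set: R] B.
  have mqc : measurable_fun [set: _] (fun z => (q (@cons_rV R 2 z))%:E).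
    by apply/measurable_EFinP; exact: measurableT_comp mq mc.
  by apply: (@measurable_fun_fubini_tonelli_F _ _ _ _ _ _ _ mqc).
have NE : N = \int[leb]_x B x.
  by rewrite /N integral_lebesgue_rV_consl//; exact/measurable_EFinP.
pose b x := \int[lebesgue_rV R 2]_v (phi (cons_rV (x, v)) ^+ 2)%:E.
have b0 x : 0 <= b x by apply: integral_ge0 => v _; rewrite lee_fin sqr_ge0.
have mphi2 x : measurable_fun [set: 'rV[R]_2] (fun v => phi (cons_rV (x, v)) ^+ 2)%R.
  by apply: measurable_funX; exact: measurableT_comp mphi (mcx x).
have mqG : measurable_fun [set: 'rV[R]_2]
    (fun v => \int[leb]_t (q (cons_rV (t, v)))%:E).
  have mqc : measurable_fun [set: _] (fun z => (q (@cons_rV R 2 z))%:E).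
    by apply/measurable_EFinP; exact: measurableT_comp mq mc.
  by apply: (@measurable_fun_fubini_tonelli_G _ _ _ _ _ leb _ mqc).
have bN x : b x <= N.
  rewrite /N integral_lebesgue_rV_consr//; last exact/measurable_EFinP.
  apply: ge0_le_integral => //.
  - by move=> v _; rewrite lee_fin sqr_ge0.
  - exact/measurable_EFinP.
  move=> v _.
  apply: (@test_function_line_H1density _ _ _ ord0 (fun t => cons_rV (t, v)) x tphi).
    by move=> t j; rewrite !mxE; case: unliftP => [k|] ->; rewrite ?eqxx.
  exact: (measurableT_comp mc (pair2_measurable v)).
(* The Cauchy-Schwarz bound on the slice for the integral of |2 phi d_i phi|; the 4 is the square of
   the factor 2. *)
pose Z x := (4%:E * b x) `^ 2^-1 * (B x) `^ 2^-1.
have aZ x i : \int[lebesgue_rV R 2]_v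
    (`|2 * phi (cons_rV (x, v)) * partial i phi (cons_rV (x, v))|)%:E <= Z x.
  have m1 : measurable_fun [set: 'rV[R]_2] (fun v => 2 * phi (cons_rV (x, v)))%R.
    by apply: measurable_funM => //; exact: measurableT_comp mphi (mcx x).
  have m2 : measurable_fun [set: 'rV[R]_2] (fun v => partial i phi (cons_rV (x, v))).
    exact: measurableT_comp (mp i) (mcx x).
  apply: le_trans (cauchy_schwarz_ereal _ m1 m2) _.
  rewrite (_ : \int[_]_v ((2 * _) ^+ 2)%:E = 4%:E * b x); last first.
    rewrite /b -ge0_integralZl//; last 2 first.
    - exact/measurable_EFinP.
    - by move=> v _; rewrite lee_fin sqr_ge0.
    by apply: eq_integral => v _; rewrite -EFinM; congr _%:E; ring.
  apply: lee_pmul; rewrite ?poweR_ge0//.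
  apply: gt0_ler_poweR => //.
  - by rewrite in_itv/= leey integral_ge0// => v _; rewrite lee_fin sqr_ge0.
  - by rewrite in_itv/= leey B0.
  apply: ge0_le_integral => //.
  - by move=> v _; rewrite lee_fin sqr_ge0.
  - by apply/measurable_EFinP; exact: measurable_funX.
  - by apply/measurable_EFinP; exact: measurableT_comp mq (mcx x).
  - by move=> v _; rewrite lee_fin sqr_partial_le_H1density.
have ZZ x : Z x * Z x <= 4%:E * N * B x.
  rewrite /Z muleACA !poweR_half_sqr//; last by rewrite mule_ge0.
  by rewrite lee_pmul ?mule_ge0// lee_pmul.
rewrite integral_lebesgue_rV_consl; last 2 first.
- by apply/measurable_EFinP; exact: measurable_funX.
- by move=> w; rewrite lee_fin -[4%N]/(2 * 2)%N exprM sqr_ge0.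
(* One factor N is the uniform bound for [b x], the other arises by integrating [B x] over the
   slices. *)
rewrite muleA [X in _ <= _ * X]NE -ge0_integralZl//; last by rewrite mule_ge0.
apply: ge0_le_integral => //.
- by move=> x _; apply: integral_ge0 => v _; rewrite lee_fin -[4%N]/(2 * 2)%N exprM sqr_ge0.
- have m4c : measurable_fun [set: _] (fun z => (phi (@cons_rV R 2 z) ^+ 4)%:E).
    apply/measurable_EFinP; apply: measurable_funX.
    exact: measurableT_comp mphi mc.
  apply: (@measurable_fun_fubini_tonelli_F _ _ _ _ _ _ _ m4c) => z.
  by rewrite lee_fin -[4%N]/(2 * 2)%N exprM sqr_ge0.
- exact: emeasurable_funM.
move=> x _; apply: le_trans (ZZ x).
have := @integral_sqr_le_rV2 R (fun v => phi (cons_rV (x, v)) ^+ 2)%R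
  (fun v => `|2 * phi (cons_rV (x, v)) * partial (lift ord0 ord0) phi (cons_rV (x, v))|)%R
  (fun v => `|2 * phi (cons_rV (x, v)) * partial (lift ord0 (lift ord0 ord0)) phi (cons_rV (x, v))|)%R.
under eq_integral do rewrite -exprM.
have ma i : measurable_fun [set: 'rV[R]_2]
  (fun v => `|2 * phi (cons_rV (x, v)) * partial i phi (cons_rV (x, v))|)%R.
  apply: measurableT_comp => //; apply: measurable_funM.
    by apply: measurable_funM => //; exact: measurableT_comp mphi (mcx x).
  exact: measurableT_comp (mp i) (mcx x).
move=> /(_ (mphi2 x) (ma _) (ma _)) h; apply: le_trans (h _ _ _ _ _) _ => //.
- by move=> w; exact: sqr_ge0.
- move=> y z; apply: (@test_function_line _ _ _ _ tphi (fun s => cons_rV (x, rV2 s z)) y).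
  move=> t j; rewrite /rV2 !mxE; case: unliftP => [k|] ->//=.
  by rewrite !mxE; case: unliftP => [l|] ->; rewrite ?eqxx.
- move=> y z; apply: (@test_function_line _ _ _ _ tphi (fun s => cons_rV (x, rV2 y s)) z).
  move=> t j; rewrite /rV2 !mxE; case: unliftP => [k|] ->//=.
  rewrite !mxE; case: unliftP => [l|] ->//=.
  by rewrite !mxE; case: unliftP => [[]//|] ->; rewrite eqxx.
by apply: lee_pmul; rewrite ?aZ// integral_ge0.
Qed.

End ladyzhenskaya.

(** * The embedding of H^1_0 in L^4 *)

Section ae_convergence.
Context d0 (T : measurableType d0) (R : realType)
  (mu : {measure set T -> \bar R}) (D : set T) (mD : measurable D).
Local Open Scope ereal_scope.

(** The sum of the h k has a finite integral by monotone convergence, so it is finite almost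
    everywhere; there each term is squeezed by the tail of a convergent series. *)
Lemma ae_cvg_of_integral_series (h : nat -> T -> R) :
  (forall k, measurable_fun D (h k)) -> (forall k x, (0 <= h k x)%R) ->
  \sum_(0 <= k <oo) \int[mu]_(x in D) (h k x)%:E < +oo ->
  {ae mu, forall x, D x -> h ^~ x @ \oo --> (0 : R)%R}.
Proof.
move=> mh h0 hy.
have mhE k : measurable_fun D (fun x => (h k x)%:E) by exact/measurable_EFinP.
have h0E k x : D x -> 0 <= (h k x)%:E by rewrite lee_fin.
have iS : mu.-integrable D (fun x => \sum_(0 <= k <oo) (h k x)%:E).
  apply/integrableP; split.
    by apply: ge0_emeasurable_sum => // k x Dx _; exact: h0E.
  rewrite (eq_integral (fun x => \sum_(0 <= k <oo) (h k x)%:E)).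
    by rewrite integral_nneseries.
  by move=> x _; rewrite gee0_abs// nneseries_ge0// => k _ _; rewrite lee_fin.
have := integrable_ae mD iS; apply: filterS => x fx Dx.
have Sy : \sum_(0 <= k <oo) (h k x)%:E < +oo.
  by have := fx Dx; rewrite ge0_fin_numE// nneseries_ge0// => k _ _; rewrite lee_fin.
have := nneseries_tail_cvg Sy; move=> /(_ (fun k _ => h0E k x Dx)) tl.
have : (h k x)%:E @[k --> \oo] --> 0%:E.
  apply: (@squeeze_cvge _ _ _ _ (cst 0) _ (fun N => \sum_(N <= k <oo) (h k x)%:E)) => //.
    near=> k; rewrite lee_fin h0 /=.
    rewrite (@nneseries_split _ _ k 1)//; last by move=> j _; exact: h0E.
    by rewrite addn1 big_nat1 leeDl// nneseries_ge0// => j _ _; rewrite lee_fin.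
  exact: cvg_cst.
by move/fine_cvg.
Unshelve. all: by end_near. Qed.

Lemma integral_le_of_ae_cvg (F : nat -> T -> R) (G : T -> R) (C : \bar R) :
  (forall k, measurable_fun D (F k)) -> measurable_fun D G ->
  (forall k x, (0 <= F k x)%R) -> (forall x, (0 <= G x)%R) ->
  {ae mu, forall x, D x -> F ^~ x @ \oo --> G x} ->
  (forall k, \int[mu]_(x in D) (F k x)%:E <= C) ->
  \int[mu]_(x in D) (G x)%:E <= C.
Proof.
move=> mF mG F0 G0 [N [mN muN sub]] FC.
have mDN : measurable (D `\` N) by exact: measurableD.
(* Off the null set convergence holds at every point, so G is there the lower limit that Fatou's
   lemma speaks about. *)
rewrite (@ge0_negligible_integral _ _ _ mu D N)//; last 2 first.
- exact/measurable_EFinP.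
- by move=> x _; rewrite lee_fin.
rewrite (eq_integral (fun x => limn_einf (fun k => (F k x)%:E))); last first.
  move=> x /set_mem[Dx Nx].
  have Fx : F ^~ x @ \oo --> G x.
    by apply: contrapT => h; apply: Nx; apply: sub => /(_ Dx).
  have FxE : (fun k => (F k x)%:E) @ \oo --> (G x)%:E by apply: cvg_EFin => //; exact: nearW.
  rewrite is_cvg_limn_einfE; last by apply/cvg_ex; eexists; exact: FxE.
  by apply/esym/cvg_lim.
apply: le_trans (fatou _ mDN _ _) _ => //.
- move=> k; apply/measurable_EFinP; exact: measurable_funS (mF k).
- by move=> k x _; rewrite lee_fin.
rewrite limn_einf_lim; apply: lime_le; first exact: is_cvg_einfs.
apply: nearW => k; apply: (@le_trans _ _ (\int[mu]_(x in D `\` N) (F k x)%:E)).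
  by apply: ereal_inf_lbound; exists k => //=.
apply: le_trans (FC k); apply: ge0_subset_integral => //.
  exact/measurable_EFinP.
by move=> x _; rewrite lee_fin.
Qed.

End ae_convergence.

Section H10_theory.
Context (R : realType) (d : nat) (hd : d = 2%N \/ d = 3%N).
Local Notation E := 'rV[R]_d.
Local Notation mu := (lebesgue_rV R d).
Variable Omega : set E.
Hypothesis oOmega : open Omega.
Hypothesis bOmega : bounded_set Omega.

Let mOmega : measurable Omega. Proof. exact: open_measurable_rV. Qed.

Lemma L2norm_sqr m n (F : E -> 'M[R]_(m, n)) :
  L2norm Omega F ^+ 2 = L2mxdot Omega F F.
Proof. by rewrite sqr_sqrtr// Rintegral_ge0// => x _; exact: ddot_ge0. Qed.

Lemma L2mx_ddot_Rintegrable m n (F G : E -> 'M[R]_(m, n)) :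
  L2mx Omega F -> L2mx Omega G ->
  Rintegrable mu Omega (fun x => ddot (F x) (G x)).
Proof.
move=> hF hG; apply: Rintegrable_sum => // i; apply: Rintegrable_sum => // j.
exact: square_integrableM (hF i j) (hG i j).
Qed.

Lemma L2_sqr_Rintegrable f : L2 Omega f -> Rintegrable mu Omega (fun x => f x ^+ 2).
Proof. by case. Qed.

Lemma L2mxB m n (F G : E -> 'M[R]_(m, n)) :
  L2mx Omega F -> L2mx Omega G -> L2mx Omega (fun x => F x - G x).
Proof.
move=> hF hG i j; apply: eq_square_integrable (square_integrableB mOmega (hF i j) (hG i j)) => // x _.
by rewrite !mxE.
Qed.

Lemma L2mx_gradient phi : test_function Omega phi -> L2mx Omega (gradient phi).
Proof.
move=> tphi i j.
apply: (@eq_square_integrable _ _ _ _ _ mOmega (partial j phi)).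
  by move=> x _; rewrite mxE.
exact: (test_function_L2 oOmega bOmega (test_functionP j tphi)).
Qed.

(** The squared H^1 norm, written as [H10] measures the distance to a test function. *)
Definition H1sq (f : E -> R) (g : E -> E) : R :=
  \int[mu]_(x in Omega) (f x ^+ 2) + L2norm Omega g ^+ 2.

Lemma H1sq_ge0 f g : 0 <= H1sq f g.
Proof. by rewrite addr_ge0 ?sqr_ge0// Rintegral_ge0// => x _; exact: sqr_ge0. Qed.

Lemma H1density_Rintegrable f g : L2 Omega f -> L2mx Omega g ->
  Rintegrable mu Omega (H1density f g).
Proof.
by move=> /L2_sqr_Rintegrable sf hg; exact (RintegrableD mOmega sf (L2mx_ddot_Rintegrable hg hg)).
Qed.

Lemma H1sqE f g : L2 Omega f -> L2mx Omega g ->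
  H1sq f g = \int[mu]_(x in Omega) H1density f g x.
Proof.
move=> /L2_sqr_Rintegrable sf hg; rewrite /H1sq L2norm_sqr -RintegralD//.
exact: L2mx_ddot_Rintegrable.
Qed.

(** Replaces the triangle inequality for squared norms: 2 a^2 + 2 (a - b)^2 - b^2 = (2 a - b)^2. *)
Lemma H1sq_le_subr f1 g1 f2 g2 : L2 Omega f1 -> L2mx Omega g1 ->
  L2 Omega f2 -> L2mx Omega g2 ->
  H1sq f2 g2 <= 2 * H1sq f1 g1 +
    2 * H1sq (fun x => f1 x - f2 x) (fun x => g1 x - g2 x).
Proof.
move=> h1 k1 h2 k2.
have h12 := square_integrableB mOmega h1 h2; have k12 := L2mxB k1 k2.
have s1 := H1density_Rintegrable h1 k1; have s12 := H1density_Rintegrable h12 k12.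
rewrite !H1sqE// -!RintegralZl// -RintegralD//; try exact: RintegrableZ.
apply: le_Rintegral => //; first exact: H1density_Rintegrable.
  by apply: RintegrableD => //; exact: RintegrableZ.
move=> x _; rewrite /H1density !ddot_row.
have : \sum_i g2 x ord0 i * g2 x ord0 i <=
    2 * (\sum_i g1 x ord0 i * g1 x ord0 i) +
    2 * (\sum_i (g1 x - g2 x) ord0 i * (g1 x - g2 x) ord0 i).
  rewrite !mulr_sumr -big_split/=; apply: ler_sum => i _; rewrite !mxE.
  by have := sqr_ge0 (2 * g1 x ord0 i - g2 x ord0 i); lra.
have : f2 x ^+ 2 <= 2 * f1 x ^+ 2 + 2 * (f1 x - f2 x) ^+ 2.
  by have := sqr_ge0 (2 * f1 x - f2 x); lra.
by move=> u v; rewrite /= in u v *; lra.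
Qed.

Lemma sqr_coord_le_H1sq f g i : L2 Omega f -> L2mx Omega g ->
  \int[mu]_(x in Omega) (g x ord0 i ^+ 2) <= H1sq f g.
Proof.
move=> hf hg; rewrite H1sqE//; apply: le_Rintegral => //.
- by case: (hg ord0 i).
- exact: H1density_Rintegrable.
move=> x _; apply: le_trans (sqr_coord_le_ddot _ i) _.
by rewrite lerDr sqr_ge0.
Qed.

Lemma sqr_le_H1sq f g : L2 Omega f -> L2mx Omega g ->
  \int[mu]_(x in Omega) (f x ^+ 2) <= H1sq f g.
Proof. by move=> hf hg; rewrite lerDl sqr_ge0. Qed.

Lemma integral_test_function (f : E -> R) :
  (forall x, ~ Omega x -> f x = 0) ->
  (\int[mu]_(x in Omega) (f x)%:E = \int[mu]_x (f x)%:E)%E.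
Proof.
move=> f0; rewrite integral_mkcond; apply: eq_integral => x _.
by rewrite patchE; case: ifPn => // /negP nx; rewrite f0// => /mem_set.
Qed.

(** Both integrands vanish off [Omega], so the whole-space bounds carry over. The constant 4 comes
    from dimension three and is generous for the planar bound, whose constant is 1. *)
Lemma test_function_L4 phi : test_function Omega phi ->
  (\int[mu]_(x in Omega) (phi x ^+ 4)%:E <=
   (4 * H1sq phi (gradient phi) ^+ 2)%:E)%E.
Proof.
move=> tphi.
have hphi := test_function_L2 oOmega bOmega tphi.
have hgrad := L2mx_gradient tphi.
rewrite H1sqE// EFinM expr2 EFinM.
rewrite Rintegrable_fin//; last exact: H1density_Rintegrable.
rewrite !integral_test_function.
- case: hd => dE; move: Omega phi tphi {hphi hgrad}; rewrite dE => O phi tphi.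
  + apply: le_trans (test_function_L4_rV2 tphi) _.
    set N := (X in (X * X)%E).
    have N0 : (0 <= N * N)%E.
      by rewrite mule_ge0//; apply: integral_ge0 => x _; rewrite lee_fin H1density_ge0.
    by rewrite -[leLHS]mul1e lee_wpmul2r// lee_fin ler1n.
  + exact: (test_function_L4_rV3 tphi).
- move=> x nx; rewrite /H1density (test_function_notin tphi nx) expr0n add0r.
  rewrite ddot_row big1// => i _.
  by rewrite mxE (test_function_partial_notin _ tphi nx) mul0r.
- by move=> x nx; rewrite (test_function_notin tphi nx) expr0n.
Qed.

(* Being an H^1 limit of test functions, without the weak gradient that H10 also
   records: this way test functions belong to the class without integrating by
   parts. *)
Definition H10_approx f g := [/\ L2 Omega f, L2mx Omega g &
  forall eps, 0 < eps -> exists2 phi, test_function Omega phi &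
    H1sq (fun x => f x - phi x) (fun x => g x - gradient phi x) < eps].

Lemma H10_approxP f g : H10 Omega f g -> H10_approx f g.
Proof. by move=> [[hf hg _] h]; split. Qed.

Lemma H1sq0 : H1sq (fun=> 0) (fun=> 0) = 0.
Proof.
rewrite H1sqE; last 2 first.
- exact: square_integrable0.
- by move=> i j; apply: eq_square_integrable (square_integrable0 _ _) => // x _; rewrite mxE.
rewrite /Rintegral (eq_integral (cst 0%E)) ?integral0// => x _.
by rewrite /H1density expr0n ddot_row big1 ?addr0// => i _; rewrite mxE mul0r.
Qed.

Lemma H10_approx_test phi : test_function Omega phi -> H10_approx phi (gradient phi).
Proof.
move=> tphi; split.
- exact: test_function_L2.
- exact: L2mx_gradient.
move=> eps eps0; exists phi => //.
rewrite (_ : (fun x => _) = fun=> 0); last by apply/funext => x; rewrite subrr.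
rewrite (_ : (fun x => _ - gradient phi x) = fun=> 0); last first.
  by apply/funext => x; rewrite subrr.
by rewrite H1sq0.
Qed.

Lemma gradientB phi psi : test_function Omega phi -> test_function Omega psi ->
  gradient (fun x => phi x - psi x) = fun x => gradient phi x - gradient psi x.
Proof.
move=> [s1 _ _] [s2 _ _]; apply/funext => x; apply/rowP => i; rewrite !mxE.
rewrite (_ : (fun x => phi x - psi x) = fun x => phi x + (-1) * psi x).
  by rewrite partialD ?mulN1r//; exact: smooth_differentiable.
by apply/funext => y; rewrite mulN1r.
Qed.

Lemma H10_approxB f g psi : H10_approx f g -> test_function Omega psi ->
  H10_approx (fun x => f x - psi x) (fun x => g x - gradient psi x).
Proof.
move=> [hf hg fg] tpsi; split.
- exact: (square_integrableB mOmega hf (test_function_L2 oOmega bOmega tpsi)).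
- exact: L2mxB hg (L2mx_gradient tpsi).
move=> eps /fg[phi tphi h]; exists (fun x => phi x - psi x).
  exact: test_functionB.
rewrite gradientB//; apply: le_lt_trans h.
rewrite le_eqVlt; apply/orP; left; apply/eqP; congr (H1sq _ _).
  by apply/funext => x; ring.
by apply/funext => x; rewrite opprB addrA subrK.
Qed.

(** The squared distances eps / 2^(k+1) are summable, so the test functions converge almost
    everywhere without passing to a subsequence. Each distance is at most eps, hence the
    approximants have squared norm at most 2 (H1sq f g + eps), and 4 times the square of this gives
    the 16. *)
Lemma H10_approx_L4_le f g eps : H10_approx f g -> 0 < eps ->
  (\int[mu]_(x in Omega) (f x ^+ 4)%:E <= (16 * (H1sq f g + eps) ^+ 2)%:E)%E.
Proof.
move=> [hf hg fg] eps0.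
have ek0 k : 0 < eps / (2 ^ k.+1)%:R by rewrite divr_gt0// ltr0n expn_gt0.
have /choice[phi hphi] : forall k, exists phi, test_function Omega phi /\
    H1sq (fun x => f x - phi x) (fun x => g x - gradient phi x) <
      eps / (2 ^ k.+1)%:R.
  by move=> k; have [phi ? ?] := fg _ (ek0 k); exists phi.
have tphi k := (hphi k).1.
have p2 k := test_function_L2 oOmega bOmega (tphi k).
have fp2 k := square_integrableB mOmega hf (p2 k).
apply: (@integral_le_of_ae_cvg _ _ _ mu Omega mOmega (fun k x => phi k x ^+ 4)).
- by move=> k; exact (measurable_funX 4 (p2 k).1).
- exact (measurable_funX 4 hf.1).
- by move=> k x; rewrite -[4%N]/(2 * 2)%N exprM sqr_ge0.
- by move=> x; rewrite -[4%N]/(2 * 2)%N exprM sqr_ge0.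
- have cv : {ae mu, forall x, Omega x ->
      (fun k => (f x - phi k x) ^+ 2) @ \oo --> (0 : R)}.
    apply: (@ae_cvg_of_integral_series _ _ _ mu Omega mOmega
      (fun k x => (f x - phi k x) ^+ 2)).
  + by move=> k; exact (measurable_funX 2 (fp2 k).1).
  + by move=> k x; exact: sqr_ge0.
  + apply: (@le_lt_trans _ _ eps%:E); last exact: ltry.
    apply: le_trans (epsilon_trick0 _ (ltW eps0)).
    apply: lee_nneseries => [k _ _|k _].
      by apply: integral_ge0 => x _; rewrite lee_fin sqr_ge0.
    rewrite -(Rintegrable_fin mOmega (L2_sqr_Rintegrable (fp2 k))).
    rewrite lee_fin; apply: le_trans (ltW (hphi k).2).
    apply: sqr_le_H1sq; first exact: fp2.
    exact: L2mxB hg (L2mx_gradient (tphi k)).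
  apply: filterS cv => x h Ox; have {}h := h Ox.
  have cvp : phi ^~ x @ \oo --> f x.
    apply/cvgrPdist_lt => e e0.
    have /cvgrPdist_lt/(_ (e ^+ 2)) := h; rewrite exprn_gt0// => /(_ isT).
    apply: filterS => k; rewrite sub0r normrN normrX => hk.
    by rewrite -(@ltr_pXn2r _ 2)// ?nnegrE// ltW.
  by apply: (@continuous_cvg _ _ _ _ _ _ (fun y : R => y ^+ 4) _ _ cvp); exact: exprn_continuous.
- move=> k; apply: le_trans (test_function_L4 (tphi k)) _.
  rewrite lee_fin.
  have e1 : eps / (2 ^ k.+1)%:R <= eps.
    rewrite ler_pdivrMr ?ltr0n ?expn_gt0//.
    by rewrite ler_peMr ?(ltW eps0)// ler1n expn_gt0.
  have := H1sq_le_subr hf hg (p2 k) (L2mx_gradient (tphi k)).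
  have := le_trans (ltW (hphi k).2) e1.
  have := H1sq_ge0 (phi k) (gradient (phi k)); have := H1sq_ge0 f g.
  set a := H1sq f g; set b := H1sq (phi k) _; set c := H1sq _ _.
  move=> a0 b0 ce bac.
  have bl : b <= 2 * (a + eps) by lra.
  have : b ^+ 2 <= (2 * (a + eps)) ^+ 2 by rewrite lerXn2r ?nnegrE// (le_trans b0).
  by lra.
Qed.

End H10_theory.

(** * Skew-symmetry and integration by parts *)

Section trilinear_form.
Context (R : realType) (d : nat) (hd : d = 2%N \/ d = 3%N).
Local Notation E := 'rV[R]_d.
Local Notation mu := (lebesgue_rV R d).
Variable Omega : set E.
Hypothesis oOmega : open Omega.
Hypothesis bOmega : bounded_set Omega.

Let mOmega : measurable Omega. Proof. exact: open_measurable_rV. Qed.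

Lemma H10_approx_L4 f g : H10_approx Omega f g ->
  L2 Omega (fun x => f x ^+ 2) /\
  \int[mu]_(x in Omega) ((f x ^+ 2) ^+ 2) <= 16 * H1sq Omega f g ^+ 2.
Proof.
move=> hfg; have [hf hg _] := hfg.
have mf2 : measurable_fun Omega (fun x => f x ^+ 2) := measurable_funX 2 hf.1.
have le4 eps : 0 < eps -> (\int[mu]_(x in Omega) ((f x ^+ 2) ^+ 2)%:E <=
    (16 * (H1sq Omega f g + eps) ^+ 2)%:E)%E.
  move=> eps0; under eq_integral do rewrite -exprM.
  exact: (H10_approx_L4_le hd oOmega bOmega hfg eps0).
have s4 : Rintegrable mu Omega (fun x => (f x ^+ 2) ^+ 2).
  apply: Rintegrable_fing => //.
  - exact (measurable_funX 2 mf2).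
  - by move=> x _; exact: sqr_ge0.
  - by apply: le_lt_trans (le4 1 ltr01) _; exact: ltry.
split; first by split.
have h0 := H1sq_ge0 Omega f g; set H := H1sq _ _ _ in h0 le4 *.
have {}le4 eps : 0 < eps ->
    \int[mu]_(x in Omega) ((f x ^+ 2) ^+ 2) <= 16 * (H + eps) ^+ 2.
  by move=> /le4; rewrite -(Rintegrable_fin mOmega s4) lee_fin.
apply/ler_addgt0Pr => e e0.
(* For eta <= 1 the excess 16 ((H + eta)^2 - H^2) is at most 16 eta (2 H + 1), which this choice
   keeps below e. *)
pose eta := Num.min 1 (e / (16 * (2 * H + 1))).
have H1 : 0 < 16 * (2 * H + 1) by lra.
have eta0 : 0 < eta by rewrite lt_min ltr01 divr_gt0.
have eta1 : eta <= 1 by rewrite ge_min lexx.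
have etae : eta * (16 * (2 * H + 1)) <= e.
  by rewrite -ler_pdivlMr// ge_min lexx orbT.
by apply: le_trans (le4 _ eta0) _; nra.
Qed.

Lemma H10_approx_mul f g w k : H10_approx Omega f g -> H10_approx Omega w k ->
  L2 Omega (fun x => f x * w x) /\
  \int[mu]_(x in Omega) ((f x * w x) ^+ 2) <= 16 * H1sq Omega f g * H1sq Omega w k.
Proof.
move=> hf hw; have [sf lf] := H10_approx_L4 hf; have [sw lw] := H10_approx_L4 hw.
have s := square_integrableM mOmega sf sw.
have E2 x : f x ^+ 2 * w x ^+ 2 = (f x * w x) ^+ 2 by ring.
split.
  split; first by case: hf => -[mf _] _ _; case: hw => -[mw _] _ _; exact: measurable_funM.
  by apply: eq_Rintegrable s => // x _.
have := cauchy_schwarz_Rintegral mOmega sf sw.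
under eq_Rintegral do rewrite E2.
have := H1sq_ge0 Omega f g; have := H1sq_ge0 Omega w k.
set F := H1sq _ f g in lf *; set W := H1sq _ w k in lw *.
set I := Rintegral _ _ _ in lf *; set J := Rintegral _ _ _ in lw *; set K := Rintegral _ _ _.
move=> W0 F0 h.
have K0 : 0 <= K by apply: Rintegral_ge0 => x _; exact: sqr_ge0.
have I0 : 0 <= I by apply: Rintegral_ge0 => x _; exact: sqr_ge0.
have J0 : 0 <= J by apply: Rintegral_ge0 => x _; exact: sqr_ge0.
rewrite -(@ler_pXn2r _ 2)// ?nnegrE ?mulr_ge0//.
apply: le_trans h _; apply: le_trans (ler_pM _ _ lf lw) _ => //.
by rewrite le_eqVlt; apply/orP; left; apply/eqP; ring.
Qed.

(** The bound [H] is left free: a squared H^1 norm when the estimate matters, the integral itself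
    (by [lexx]) when only integrability is wanted. *)
Lemma triple_product f g w k h H : H10_approx Omega f g ->
  H10_approx Omega w k -> L2 Omega h -> \int[mu]_(x in Omega) (h x ^+ 2) <= H ->
  Rintegrable mu Omega (fun x => f x * w x * h x) /\
  (\int[mu]_(x in Omega) (f x * w x * h x)) ^+ 2 <=
    16 * H1sq Omega f g * H1sq Omega w k * H.
Proof.
move=> hf hw hh hH; have [sfw lfw] := H10_approx_mul hf hw.
split; first exact: square_integrableM.
apply: le_trans (cauchy_schwarz_Rintegral mOmega sfw hh) _.
by apply: ler_pM => //; apply: Rintegral_ge0 => x _; exact: sqr_ge0.
Qed.

(** The form in which density is used: x does not depend on phi, while the right-hand side can be
    made as small as desired. No sign of C is assumed, hence the division by |C| + 1 in the
    proof. *)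
Lemma H10_density_eq0 f g (x C : R) : H10_approx Omega f g ->
  (forall phi, test_function Omega phi -> x ^+ 2 <=
    C * H1sq Omega (fun y => f y - phi y) (fun y => g y - gradient phi y)) ->
  x = 0.
Proof.
move=> [_ _ fg] h; apply/eqP; rewrite -sqrf_eq0; apply/eqP/le_anti.
rewrite sqr_ge0 andbT; apply/ler_addgt0Pl => e e0; rewrite addr0.
have C0 : 0 < `|C| + 1 by rewrite ltr_wpDl.
have [phi tphi hphi] := fg _ (divr_gt0 e0 C0).
apply: le_trans (h _ tphi) _; move: hphi.
have := H1sq_ge0 Omega (fun y => f y - phi y) (fun y => g y - gradient phi y).
set H := H1sq _ _ _ => H0; rewrite ltr_pdivlMr// => hH.
by have := ler_norm C; nra.
Qed.

Variable j : 'I_d.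
Implicit Types (b v w : E -> R) (g h k : E -> E).

(* For test functions b and w, with v weakly differentiable, this is the
   definition of the weak gradient of v tested with b * w; the general case
   follows by density, first in w and then in b. For b, v, v it is the
   skew-symmetry of the convective term. *)
Definition trilinear b g v h w k : R :=
  \int[mu]_(x in Omega) (b x * w x * h x ord0 j) +
  \int[mu]_(x in Omega) (b x * v x * k x ord0 j) +
  \int[mu]_(x in Omega) (v x * w x * g x ord0 j).

Lemma trilinearC b g v h w k : trilinear b g v h w k = trilinear w k v h b g.
Proof.
rewrite /trilinear addrAC; congr (_ + _ + _);
  by apply: eq_Rintegral => x _; ring.
Qed.

(** Each of the three integrals has square at most 16 times the product of the norms, and (x + y +
    z)^2 <= 3 (x^2 + y^2 + z^2); thus 144 = 3 * 3 * 16. *)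
Lemma trilinear_bound b g v h w k :
  H10_approx Omega b g -> H10_approx Omega v h -> H10_approx Omega w k ->
  trilinear b g v h w k ^+ 2 <=
  144 * H1sq Omega b g * H1sq Omega v h * H1sq Omega w k.
Proof.
move=> hb hv hw.
have [b2 g2 _] := hb; have [v2 h2 _] := hv; have [w2 k2 _] := hw.
have [_ l1] := triple_product hb hw (h2 ord0 j) (sqr_coord_le_H1sq oOmega j v2 h2).
have [_ l2] := triple_product hb hv (k2 ord0 j) (sqr_coord_le_H1sq oOmega j w2 k2).
have [_ l3] := triple_product hv hw (g2 ord0 j) (sqr_coord_le_H1sq oOmega j b2 g2).
rewrite /trilinear; move: l1 l2 l3.
set x := Rintegral _ _ _; set y := Rintegral _ _ _; set z := Rintegral _ _ _.
move=> l1 l2 l3.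
have := sqr_ge0 (x - y); have := sqr_ge0 (y - z); have := sqr_ge0 (x - z); lra.
Qed.

Lemma trilinearB b g v h w k phi :
  H10_approx Omega b g -> H10_approx Omega v h -> H10_approx Omega w k ->
  test_function Omega phi ->
  trilinear (fun x => b x - phi x) (fun x => g x - gradient phi x) v h w k =
  trilinear b g v h w k - trilinear phi (gradient phi) v h w k.
Proof.
move=> hb hv hw /(H10_approx_test oOmega bOmega) hphi.
have [b2 g2 _] := hb; have [v2 h2 _] := hv; have [w2 k2 _] := hw.
have [_ p2 _] := hphi.
have [s1 _] := triple_product hb hw (h2 ord0 j) (lexx _).
have [s2 _] := triple_product hb hv (k2 ord0 j) (lexx _).
have [s3 _] := triple_product hv hw (g2 ord0 j) (lexx _).
have [t1 _] := triple_product hphi hw (h2 ord0 j) (lexx _).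
have [t2 _] := triple_product hphi hv (k2 ord0 j) (lexx _).
have [t3 _] := triple_product hv hw (p2 ord0 j) (lexx _).
rewrite /trilinear !opprD !addrA.
rewrite [RHS](_ : _ = (\int[mu]_(x in Omega) (b x * w x * h x ord0 j) -
   \int[mu]_(x in Omega) (phi x * w x * h x ord0 j)) +
  (\int[mu]_(x in Omega) (b x * v x * k x ord0 j) -
   \int[mu]_(x in Omega) (phi x * v x * k x ord0 j)) +
  (\int[mu]_(x in Omega) (v x * w x * g x ord0 j) -
   \int[mu]_(x in Omega) (v x * w x * gradient phi x ord0 j))); last by ring.
rewrite -!RintegralB//; congr (_ + _ + _); apply: eq_Rintegral => x _; rewrite ?mxE; ring.
Qed.

Lemma trilinear_test phi v h psi : weak_gradient Omega v h ->
  H10_approx Omega v h ->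
  test_function Omega phi -> test_function Omega psi ->
  trilinear phi (gradient phi) v h psi (gradient psi) = 0.
Proof.
move=> [_ wv] hv tphi tpsi; have [_ hw] := wv j.
have := hw _ (test_functionM tphi tpsi).
have aphi := H10_approx_test oOmega bOmega tphi.
have apsi := H10_approx_test oOmega bOmega tpsi.
have [_ phi2 _] := aphi; have [_ psi2 _] := apsi.
have [s2 _] := triple_product aphi hv (psi2 ord0 j) (lexx _).
have [s3 _] := triple_product hv apsi (phi2 ord0 j) (lexx _).
rewrite partialM; last 2 first.
- by apply: smooth_differentiable; case: tphi.
- by apply: smooth_differentiable; case: tpsi.
move=> e; rewrite /trilinear -addrA -RintegralD//.
rewrite (_ : \int[mu]_(x in Omega) (_ + _) = - \int[mu]_(x in Omega) (h x ord0 j * (phi x * psi x))).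
  by apply/eqP; rewrite subr_eq0; apply/eqP; apply: eq_Rintegral => x _; ring.
by rewrite -e; apply: eq_Rintegral => x _; rewrite !mxE; ring.
Qed.

Lemma trilinear_eq0 b g v h w k : H10 Omega b g -> H10 Omega v h ->
  H10 Omega w k -> trilinear b g v h w k = 0.
Proof.
move=> /H10_approxP hb Hv /H10_approxP hw; have hv := H10_approxP Hv.
have wv : weak_gradient Omega v h by case: Hv => -[].
have test0 phi : test_function Omega phi ->
    trilinear phi (gradient phi) v h w k = 0.
  move=> tphi; have aphi := H10_approx_test oOmega bOmega tphi.
  apply: (H10_density_eq0 (C := 144 * H1sq Omega v h * H1sq Omega phi (gradient phi)) hw).
  move=> psi tpsi; rewrite trilinearC.
  (* The form vanishes at psi, so by linearity its value at w is its value at w - psi, which is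
     small. *)
  rewrite -[X in X ^+ 2]subr0 -(trilinear_test wv hv tpsi tphi) -trilinearB//.
  apply: le_trans (trilinear_bound (H10_approxB oOmega bOmega hw tpsi) hv aphi) _.
  by rewrite le_eqVlt; apply/orP; left; apply/eqP; ring.
apply: (H10_density_eq0 (C := 144 * H1sq Omega v h * H1sq Omega w k) hb).
move=> phi tphi; rewrite -[X in X ^+ 2]subr0 -(test0 _ tphi) -trilinearB//.
apply: le_trans (trilinear_bound (H10_approxB oOmega bOmega hb tphi) hv hw) _.
by rewrite le_eqVlt; apply/orP; left; apply/eqP; ring.
Qed.

(** Only w vanishes on the boundary. The defect of the identity is unchanged when a test function is
    subtracted from w; by Cauchy-Schwarz and (s + t)^2 <= 2 s^2 + 2 t^2 it is then bounded by the
    distance of w to that function. *)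
Lemma integration_by_parts_H10 q Dq w k : H1 Omega q Dq -> H10 Omega w k ->
  \int[mu]_(x in Omega) (q x * k x ord0 j) =
  - \int[mu]_(x in Omega) (w x * Dq x ord0 j).
Proof.
move=> [q2 Dq2 wq] /H10_approxP hw; have [w2 k2 _] := hw.
apply/eqP; rewrite -addr_eq0; apply/eqP.
have sqk := square_integrableM mOmega q2 (k2 ord0 j).
have swD := square_integrableM mOmega w2 (Dq2 ord0 j).
apply: (H10_density_eq0 (C := 2 * \int[mu]_(x in Omega) (q x ^+ 2) +
   2 * \int[mu]_(x in Omega) (Dq x ord0 j ^+ 2)) hw) => phi tphi.
have [p2 gp2 _] := H10_approx_test oOmega bOmega tphi.
have sqp := square_integrableM mOmega q2 (gp2 ord0 j).
have spD := square_integrableM mOmega p2 (Dq2 ord0 j).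
have [a2 c2 _] := H10_approxB oOmega bOmega hw tphi.
have cs1 := cauchy_schwarz_Rintegral mOmega q2 (c2 ord0 j).
have cs2 := cauchy_schwarz_Rintegral mOmega a2 (Dq2 ord0 j).
have e : \int[mu]_(x in Omega) (q x * gradient phi x ord0 j) =
    - \int[mu]_(x in Omega) (phi x * Dq x ord0 j).
  transitivity (- \int[mu]_(x in Omega) (Dq x ord0 j * phi x)).
    rewrite -((wq.2 j).2 _ tphi).
    by apply: eq_Rintegral => x _; rewrite mxE.
  by congr (- _); apply: eq_Rintegral => x _; rewrite mulrC.
have := sqr_coord_le_H1sq oOmega j a2 c2; have := sqr_le_H1sq a2 c2.
move: cs1 cs2.
rewrite (_ : \int[mu]_(x in Omega) (q x * (k x - gradient phi x) ord0 j) = \int[mu]_(x in Omega) (q x * k x ord0 j) -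
  \int[mu]_(x in Omega) (q x * gradient phi x ord0 j)); last first.
  by rewrite -RintegralB//; apply: eq_Rintegral => x _; rewrite !mxE mulrBr.
rewrite (_ : \int[mu]_(x in Omega) ((w x - phi x) * Dq x ord0 j) = \int[mu]_(x in Omega) (w x * Dq x ord0 j) -
  \int[mu]_(x in Omega) (phi x * Dq x ord0 j)); last first.
  by rewrite -RintegralB//; apply: eq_Rintegral => x _; rewrite mulrBl.
rewrite e.
set x1 := \int[mu]_(x in Omega) (q x * k x ord0 j).
set x2 := \int[mu]_(x in Omega) (w x * Dq x ord0 j).
set y := \int[mu]_(x in Omega) (phi x * Dq x ord0 j).
set q' := \int[mu]_(x in Omega) (q x ^+ 2).
set D' := \int[mu]_(x in Omega) (Dq x ord0 j ^+ 2).
have q0 : 0 <= q' by apply: Rintegral_ge0 => x _; exact: sqr_ge0.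
have D0 : 0 <= D' by apply: Rintegral_ge0 => x _; exact: sqr_ge0.
set k' := \int[mu]_(x in Omega) ((k x - gradient phi x) ord0 j ^+ 2).
set w' := \int[mu]_(x in Omega) ((w x - phi x) ^+ 2).
set H := H1sq _ _ _ => c1 c2' wH kH.
have h1 : q' * k' <= q' * H by rewrite ler_wpM2l.
have h2 : w' * D' <= H * D' by rewrite ler_wpM2r.
have := sqr_ge0 ((x1 - - y) - (x2 - y)); lra.
Qed.

End trilinear_form.

(** * Energy estimates *)

Section energy_forms.
Context (R : realType) (d : nat) (hd : d = 2%N \/ d = 3%N).
Local Notation E := 'rV[R]_d.
Local Notation mu := (lebesgue_rV R d).
Variable Omega : set E.
Hypothesis oOmega : open Omega.
Hypothesis bOmega : bounded_set Omega.

Let mOmega : measurable Omega. Proof. exact: open_measurable_rV. Qed.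

Section bilinear.
Variables m n : nat.
Implicit Types F G H : E -> 'M[R]_(m, n).

Lemma L2mxZ a F : L2mx Omega F -> L2mx Omega (fun x => a *: F x).
Proof.
move=> hF i j; apply: eq_square_integrable (square_integrableZ mOmega a (hF i j)) => // x _.
by rewrite !mxE.
Qed.

Lemma L2mxdotC F G : L2mxdot Omega F G = L2mxdot Omega G F.
Proof.
apply: eq_Rintegral => x _; apply: eq_bigr => i _; apply: eq_bigr => j _.
exact: mulrC.
Qed.

Lemma L2mxdotBl F G H : L2mx Omega F -> L2mx Omega G -> L2mx Omega H ->
  L2mxdot Omega (fun x => F x - G x) H = L2mxdot Omega F H - L2mxdot Omega G H.
Proof.
move=> hF hG hH.
have s1 := L2mx_ddot_Rintegrable oOmega hF hH.
have s2 := L2mx_ddot_Rintegrable oOmega hG hH.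
rewrite /L2mxdot -RintegralB//; apply: eq_Rintegral => x _.
rewrite /ddot -sumrB; apply: eq_bigr => i _; rewrite -sumrB.
by apply: eq_bigr => j _; rewrite !mxE mulrBl.
Qed.

Lemma L2mxdotZl a F H : L2mx Omega F -> L2mx Omega H ->
  L2mxdot Omega (fun x => a *: F x) H = a * L2mxdot Omega F H.
Proof.
move=> hF hH; have s1 := L2mx_ddot_Rintegrable oOmega hF hH.
rewrite /L2mxdot -RintegralZl//; apply: eq_Rintegral => x _.
rewrite /ddot mulr_sumr; apply: eq_bigr => i _; rewrite mulr_sumr.
by apply: eq_bigr => j _; rewrite !mxE mulrA.
Qed.

Lemma L2mxdotBr F G H : L2mx Omega F -> L2mx Omega G -> L2mx Omega H ->
  L2mxdot Omega H (fun x => F x - G x) = L2mxdot Omega H F - L2mxdot Omega H G.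
Proof. by move=> hF hG hH; rewrite L2mxdotC L2mxdotBl// !(L2mxdotC H). Qed.

Lemma L2mxdotZr a F H : L2mx Omega F -> L2mx Omega H ->
  L2mxdot Omega H (fun x => a *: F x) = a * L2mxdot Omega H F.
Proof. by move=> hF hH; rewrite L2mxdotC L2mxdotZl// L2mxdotC. Qed.

Lemma L2mxdot_ge0 F : 0 <= L2mxdot Omega F F.
Proof. by apply: Rintegral_ge0 => x _; exact: ddot_ge0. Qed.

Lemma L2mxdotBB F G : L2mx Omega F -> L2mx Omega G ->
  L2mxdot Omega (fun x => F x - G x) (fun x => F x - G x) =
  L2mxdot Omega F F - 2 * L2mxdot Omega F G + L2mxdot Omega G G.
Proof.
move=> hF hG; rewrite L2mxdotBl//; last exact: L2mxB.
by rewrite !L2mxdotBr// (L2mxdotC G F); ring.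
Qed.

Lemma L2mxdot_young c F G : 0 < c -> L2mx Omega F -> L2mx Omega G ->
  2 * L2mxdot Omega F G <= c^-1 * L2mxdot Omega F F + c * L2mxdot Omega G G.
Proof.
move=> c0 hF hG; have hcG := L2mxZ c hG.
have := L2mxdot_ge0 (fun x => F x - c *: G x).
rewrite L2mxdotBB// !L2mxdotZl// !L2mxdotZr//.
set a := L2mxdot _ F F; set b := L2mxdot _ F G; set e := L2mxdot _ G G => h.
have cc : c * c^-1 = 1 by rewrite divff ?gt_eqF.
rewrite -(ler_pM2l c0) mulrDr (mulrA c c^-1) cc mul1r; lra.
Qed.

End bilinear.

Lemma H10v_approx w Dw (i : 'I_d) : H10v Omega w Dw ->
  H10_approx Omega (fun x => w x ord0 i) (fun x => row i (Dw x)).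
Proof. by move=> hw; exact: H10_approxP. Qed.

Lemma H10v_L2 w Dw : H10v Omega w Dw -> L2mx Omega w.
Proof.
by move=> hw i j; rewrite (ord1 i); have [] := H10v_approx j hw.
Qed.

Lemma H10v_gradL2 w Dw : H10v Omega w Dw -> L2mx Omega Dw.
Proof.
move=> hw i j; have [_ h _] := H10v_approx i hw.
by apply: eq_square_integrable (h ord0 j) => // x _; rewrite mxE.
Qed.

(** The sum over i and j of the vanishing [trilinear] forms in b_j, v_i, v_i. The half-divergence
    term compensates for b not being divergence-free. *)
Lemma convection_skew b Db v Dv : H10v Omega b Db -> H10v Omega v Dv ->
  L2mxdot Omega (gradmul Dv b) v +
  2^-1 * L2mxdot Omega (fun x => divergence Db x *: v x) v = 0.
Proof.
move=> hb hv.
have s1 i j : Rintegrable mu Omega (fun x => b x ord0 j * v x ord0 i * Dv x i j).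
  have [s _] := triple_product hd oOmega bOmega (H10v_approx j hb) (H10v_approx i hv)
    (H10v_gradL2 hv i j) (lexx _).
  exact: s.
have s2 i j : Rintegrable mu Omega (fun x => v x ord0 i * v x ord0 i * Db x j j).
  have [s _] := triple_product hd oOmega bOmega (H10v_approx i hv) (H10v_approx i hv)
    (H10v_gradL2 hb j j) (lexx _).
  exact: s.
have t i j : 2 * \int[mu]_(x in Omega) (b x ord0 j * v x ord0 i * Dv x i j) +
    \int[mu]_(x in Omega) (v x ord0 i * v x ord0 i * Db x j j) = 0.
  have := trilinear_eq0 hd oOmega bOmega j (hb j) (hv i) (hv i).
  rewrite /trilinear.
  rewrite (_ : \int[mu]_(x in Omega) (v x ord0 i * v x ord0 i * row j (Db x) ord0 j) =
    \int[mu]_(x in Omega) (v x ord0 i * v x ord0 i * Db x j j)); last first.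
    by apply: eq_Rintegral => x _; rewrite mxE.
  rewrite (_ : \int[mu]_(x in Omega) (b x ord0 j * v x ord0 i * row i (Dv x) ord0 j) =
    \int[mu]_(x in Omega) (b x ord0 j * v x ord0 i * Dv x i j)); last first.
    by apply: eq_Rintegral => x _; rewrite mxE.
  by move=> <-; ring.
have -> : L2mxdot Omega (gradmul Dv b) v =
    \sum_i \sum_j \int[mu]_(x in Omega) (b x ord0 j * v x ord0 i * Dv x i j).
  under eq_bigr do rewrite -Rintegral_sum//.
  rewrite -Rintegral_sum//; last by move=> i; exact: Rintegrable_sum.
  apply: eq_Rintegral => x _; rewrite ddot_row; apply: eq_bigr => i _.
  by rewrite mxE mulr_suml; apply: eq_bigr => j _; rewrite mxE; ring.
have -> : L2mxdot Omega (fun x => divergence Db x *: v x) v =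
    \sum_i \sum_j \int[mu]_(x in Omega) (v x ord0 i * v x ord0 i * Db x j j).
  under eq_bigr do rewrite -Rintegral_sum//.
  rewrite -Rintegral_sum//; last by move=> i; exact: Rintegrable_sum.
  apply: eq_Rintegral => x _; rewrite ddot_row; apply: eq_bigr => i _.
  by rewrite mxE -mulrA /divergence mulr_suml; apply: eq_bigr => j _; ring.
rewrite mulr_sumr -big_split big1// => i _.
rewrite /= mulr_sumr -big_split big1// => j _ /=.
by have := t i j; lra.
Qed.

Lemma divergence_by_parts q Dq w Dw : H1 Omega q Dq -> H10v Omega w Dw ->
  L2dot Omega (divergence Dw) q = - L2mxdot Omega w Dq.
Proof.
move=> hq hw; have [q2 Dq2 _] := hq.
have s1 i : Rintegrable mu Omega (fun x => q x * row i (Dw x) ord0 i).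
  by have [_ h _] := H10v_approx i hw; exact (square_integrableM mOmega q2 (h ord0 i)).
have s2 i : Rintegrable mu Omega (fun x => w x ord0 i * Dq x ord0 i).
  exact (square_integrableM mOmega (H10v_L2 hw ord0 i) (Dq2 ord0 i)).
transitivity (\sum_i \int[mu]_(x in Omega) (q x * row i (Dw x) ord0 i)).
  rewrite -Rintegral_sum//; apply: eq_Rintegral => x _.
  by rewrite /divergence mulr_suml; apply: eq_bigr => i _; rewrite mxE mulrC.
transitivity (- \sum_i \int[mu]_(x in Omega) (w x ord0 i * Dq x ord0 i)).
  rewrite -sumrN; apply: eq_bigr => i _.
  by rewrite (integration_by_parts_H10 oOmega bOmega i hq (hw i)).
congr (- _); rewrite -Rintegral_sum//; apply: eq_Rintegral => x _.
by rewrite ddot_row.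
Qed.

Lemma L2_Rintegrable f : L2 Omega f -> Rintegrable mu Omega f.
Proof.
move=> hf.
have s1 : Rintegrable mu Omega (fun=> 1).
  apply: measurable_bounded_integrable => //.
    exact: bounded_set_lebesgue_rV.
  by exists 1; split; [exact: num_real|] => K K1 x _; rewrite normr1 ltW.
apply: Rintegrable_le (RintegrableD mOmega s1 (L2_sqr_Rintegrable hf)) _ => //.
  by case: hf.
move=> x _; rewrite ler_norml; apply/andP; split.
  by have := sqr_ge0 (f x + 1); have := sqr_ge0 (f x); lra.
by have := sqr_ge0 (f x - 1); have := sqr_ge0 (f x); lra.
Qed.

End energy_forms.

(** * The viscosity-gradient term and the admissible pressures *)

Section estimates.
Context (R : realType) (d : nat).
Local Notation E := 'rV[R]_d.
Local Notation mu := (lebesgue_rV R d).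
Variable Omega : set E.
Hypothesis oOmega : open Omega.
Hypothesis bOmega : bounded_set Omega.

Let mOmega : measurable Omega. Proof. exact: open_measurable_rV. Qed.

Lemma Rintegrable_ae_le (f g : E -> R) : measurable_fun Omega f ->
  Rintegrable mu Omega g -> {ae mu, forall x, Omega x -> `|f x| <= g x} ->
  Rintegrable mu Omega f.
Proof.
move=> mf sg fg; apply/integrableP; split; first exact/measurable_EFinP.
have /integrableP[mg gy] := sg; apply: le_lt_trans gy.
apply: ae_ge0_le_integral => //.
- by apply: measurableT_comp => //; exact/measurable_EFinP.
- exact: measurableT_comp.
apply: filterS fg => x fg Ox; rewrite /= lee_fin.
by apply: le_trans (fg Ox) _; exact: ler_norm.
Qed.

(** Young's inequality entry by entry, pairing A_ij with e_i v_j. The squares of the latter sum to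
    |e|^2 |v|^2, so no dimensional constant enters. The absolute value lets the bound also yield
    integrability. *)
Lemma ddot_gradT_young (a K : R) (e v : 'rV[R]_d) (A : 'M[R]_d) : 0 < a ->
  elen e <= K ->
  `|2 * ddot (e *m A) v| <= a * ddot A A + K ^+ 2 / a * ddot v v.
Proof.
move=> a0 eK.
have eK2 : ddot e e <= K ^+ 2.
  rewrite -[leLHS]sqr_sqrtr ?ddot_ge0// -/(elen e) lerXn2r// ?nnegrE ?sqrtr_ge0//.
  by apply: le_trans eK; exact: sqrtr_ge0.
have -> : ddot (e *m A) v = \sum_i \sum_j A i j * (e ord0 i * v ord0 j).
  rewrite ddot_row exchange_big; apply: eq_bigr => j _.
  by rewrite mxE mulr_suml; apply: eq_bigr => i _; ring.
have S : \sum_i \sum_j (a * A i j ^+ 2 + (e ord0 i * v ord0 j) ^+ 2 / a) =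
    a * ddot A A + ddot e e / a * ddot v v.
  rewrite /ddot mulr_sumr [_ / a * _]mulrAC.
  transitivity (\sum_i ((\sum_j a * (A i j * A i j)) +
     \sum_j (e ord0 i * v ord0 j) ^+ 2 / a)).
    by apply: eq_bigr => i _; rewrite big_split.
  rewrite big_split/=; congr (_ + _).
    by apply: eq_bigr => i _; rewrite mulr_sumr.
  rewrite !big_ord_recl !big_ord0 !addr0 mulr_suml mulr_suml.
  apply: eq_bigr => i _; rewrite mulr_sumr mulr_suml; apply: eq_bigr => j _.
  by congr (_ / _); ring.
have K2 : a * ddot A A + ddot e e / a * ddot v v <= a * ddot A A + K ^+ 2 / a * ddot v v.
  rewrite lerD2l; apply: ler_wpM2r; first exact: ddot_ge0.
  by rewrite ler_wpM2r// invr_ge0 ltW.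
apply: le_trans K2; rewrite -S mulr_sumr; apply: le_trans (ler_norm_sum _ _ _) _.
apply: ler_sum => i _; rewrite mulr_sumr; apply: le_trans (ler_norm_sum _ _ _) _.
apply: ler_sum => j _.
set x := A i j; set y := e ord0 i * v ord0 j.
rewrite -(ler_pM2l a0) mulrDr [a * (_ / a)]mulrCA divff ?gt_eqF// mulr1.
rewrite -[X in X * `|_|]gtr0_norm// -normrM ler_norml; apply/andP; split.
  by have := sqr_ge0 (a * x + y); lra.
by have := sqr_ge0 (a * x - y); lra.
Qed.

Lemma L2mxdot_gradT_young (a K : R) (e v : E -> 'rV[R]_d) (A : E -> 'M[R]_d) :
  0 < a -> (forall i, measurable_fun Omega (fun x => e x ord0 i)) ->
  {ae mu, forall x, Omega x -> elen (e x) <= K} ->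
  L2mx Omega A -> L2mx Omega v ->
  2 * L2mxdot Omega (gradTmul A e) v <=
  a * L2mxdot Omega A A + K ^+ 2 / a * L2mxdot Omega v v.
Proof.
move=> a0 me eK hA hv.
have sA := L2mx_ddot_Rintegrable oOmega hA hA.
have sv := L2mx_ddot_Rintegrable oOmega hv hv.
have sr : Rintegrable mu Omega
    (fun x => a * ddot (A x) (A x) + K ^+ 2 / a * ddot (v x) (v x)).
  by apply: RintegrableD => //; exact: RintegrableZ.
have ae : {ae mu, forall x, Omega x -> `|2 * ddot (gradTmul A e x) (v x)| <=
    a * ddot (A x) (A x) + K ^+ 2 / a * ddot (v x) (v x)}.
  by apply: filterS eK => x eK Ox; apply: ddot_gradT_young => //; exact: eK.
have m2 : measurable_fun Omega (fun x => ddot (gradTmul A e x) (v x)).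
  rewrite (_ : (fun _ => _) =
      fun x => \sum_i (\sum_j e x ord0 j * A x j i) * v x ord0 i).
    apply: measurable_sum => i; apply: measurable_funM; last by case: (hv ord0 i).
    by apply: measurable_sum => j; apply: measurable_funM => //; case: (hA j i).
  by apply/funext => x; rewrite ddot_row; apply: eq_bigr => i _; rewrite mxE.
have s2 : Rintegrable mu Omega (fun x => 2 * ddot (gradTmul A e x) (v x)).
  by apply: Rintegrable_ae_le sr ae; exact: measurable_funM.
have s1 : Rintegrable mu Omega (fun x => ddot (gradTmul A e x) (v x)).
  apply: (@eq_Rintegrable _ _ _ _ _ mOmega
    (fun x => 2^-1 * (2 * ddot (gradTmul A e x) (v x)))).
    by move=> x _; rewrite mulKf.
  exact: RintegrableZ.
rewrite -!RintegralZl// -RintegralD//; try exact: RintegrableZ.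
apply: ae_le_Rintegral => //.
by apply: filterS ae => x h Ox; apply: le_trans (h Ox); exact: ler_norm.
Qed.

Lemma L1loc_lin (a : R) (f g : E -> R) : L1loc Omega f -> L1loc Omega g ->
  L1loc Omega (fun x => a * f x - g x).
Proof.
move=> [mf lf] [mg lg]; split.
  by apply: measurable_funB => //; exact: measurable_funM.
move=> K KO cK.
have mK : measurable K.
  have /closed_openC/open_measurable_rV/measurableC : closed K.
    by apply: compact_closed => //; exact: norm_hausdorff.
  by rewrite setCK.
apply: (@RintegrableB _ _ _ mu K mK (fun x => a * f x) g); last exact: lg.
by apply: RintegrableZ => //; exact: lf.
Qed.

(** Admits both pressure test functions: a = 2 gives 2 p_n - p_{n-1}, and a = 1 applied to p_{n+1}
    and that combination gives d_n. *)
Lemma H1mean0_lin (a : R) q Dq r Dr : H1mean0 Omega q Dq -> H1mean0 Omega r Dr ->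
  H1mean0 Omega (fun x => a * q x - r x) (fun x => a *: Dq x - Dr x).
Proof.
move=> [[q2 Dq2 [lq wq]] q0] [[r2 Dr2 [lr wr]] r0].
have int_L2 f := @L2_Rintegrable R d Omega oOmega bOmega f.
split; last first.
  rewrite RintegralB//; last 2 first.
  - exact/RintegrableZ/int_L2.
  - exact: int_L2.
  by rewrite RintegralZl ?q0 ?r0 ?mulr0 ?subrr//; exact: int_L2.
split.
- exact: (square_integrableB mOmega (square_integrableZ mOmega a q2) r2).
- exact: L2mxB (L2mxZ oOmega a Dq2) Dr2.
split; first exact: L1loc_lin.
move=> i; split.
  rewrite (_ : (fun x => _) = fun x => a * Dq x ord0 i - Dr x ord0 i).
    exact: L1loc_lin (wq i).1 (wr i).1.
  by apply/funext => x; rewrite !mxE.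
move=> phi tphi.
have p2 := test_function_L2 oOmega bOmega tphi.
have dp2 := test_function_L2 oOmega bOmega (test_functionP i tphi).
have s1 := square_integrableM mOmega q2 dp2.
have s2 := square_integrableM mOmega r2 dp2.
have t1 := square_integrableM mOmega (Dq2 ord0 i) p2.
have t2 := square_integrableM mOmega (Dr2 ord0 i) p2.
transitivity (a * \int[mu]_(x in Omega) (q x * partial i phi x) -
   \int[mu]_(x in Omega) (r x * partial i phi x)).
  rewrite -RintegralZl// -RintegralB//; last exact: RintegrableZ.
  by apply: eq_Rintegral => x _; ring.
rewrite (wq i).2// (wr i).2//.
transitivity (- (a * \int[mu]_(x in Omega) (Dq x ord0 i * phi x) -
   \int[mu]_(x in Omega) (Dr x ord0 i * phi x))); first by ring.
congr (- _).
rewrite -RintegralZl// -RintegralB//; last exact: RintegrableZ.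
by apply: eq_Rintegral => x _; rewrite !mxE; ring.
Qed.

Lemma H1mean0_0 : H1mean0 Omega (cst 0) (cst 0).
Proof.
have l0 : L1loc Omega (cst 0).
  split; first exact: measurable_cst.
  by move=> K _ _; exact: integrable0.
have c0 i : (fun x : E => (cst 0 x : 'rV[R]_d) ord0 i) = cst 0.
  by apply/funext => x; rewrite mxE.
split; last by rewrite /Rintegral integral0.
split.
- exact: square_integrable0.
- move=> i j; rewrite (ord1 i) c0; exact: square_integrable0.
split => // i; rewrite c0; split => // phi _.
rewrite (_ : \int[mu]_(x in Omega) (cst 0 x * partial i phi x) = 0); last first.
  by under eq_Rintegral do rewrite mul0r; rewrite /Rintegral integral0.
rewrite (_ : \int[mu]_(x in Omega) _ = 0) ?oppr0//.
by under eq_Rintegral do rewrite mxE mul0r; rewrite /Rintegral integral0.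
Qed.

End estimates.

(** * Discrete Gronwall inequality *)

(** Each step costs a factor r = 1 / (1 - b) = 1 + b / (1 - b), which is at most exp (b / (1 -
    b)). *)
Lemma discrete_gronwall (R : realType) (b : R) (N : nat) (e g h : nat -> R) :
  0 <= b < 1 -> (forall n, 0 <= e n) -> (forall n, 0 <= g n) ->
  (forall n, (0 < n <= N)%N -> 0 <= h n) ->
  (forall n, (n < N)%N -> (1 - b) * e n.+1 + g n.+1 <= e n + h n.+1) ->
  e N + \sum_(1 <= n < N.+1) g n <=
  expR (N%:R * (b / (1 - b))) * (e 0%N + \sum_(1 <= n < N.+1) h n).
Proof.
move=> /andP[b0 b1] e0 g0 h0 step.
have c0 : 0 < 1 - b by rewrite subr_gt0.
pose r := (1 - b)^-1.
have cr : (1 - b) * r = 1 by rewrite /r divff ?gt_eqF.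
have rE : r = 1 + b / (1 - b).
  by rewrite -[X in X + _](divff (lt0r_neq0 c0)) -mulrDl subrK mul1r.
have r1 : 1 <= r by rewrite rE lerDl divr_ge0// ltW.
have main n : (n <= N)%N -> e n + \sum_(1 <= k < n.+1) g k <=
    r ^+ n * (e 0%N + \sum_(1 <= k < n.+1) h k).
  elim: n => [|n IH] nN; first by rewrite !big_geq// expr0 mul1r !addr0.
  rewrite [X in _ + X]big_nat_recr//= [X in _ * (_ + X)]big_nat_recr//=.
  have := IH (ltnW nN); have := step n nN.
  set G := \sum_(1 <= k < n.+1) g k; set H := \sum_(1 <= k < n.+1) h k => hn IHn.
  have G0 : 0 <= G by apply: sumr_ge0 => k _.
  have hn0 : 0 <= h n.+1 by apply: h0.
  have rn : 1 <= r ^+ n by exact: exprn_ege1.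
  (* Scaling by 1 - b removes one factor r on the right and only shrinks the nonnegative sum of the
     g k on the left. *)
  rewrite exprSr -mulrA mulrCA -(ler_pM2l c0) [leRHS]mulrA cr mul1r.
  have gn0 := g0 n.+1.
  have : h n.+1 <= r ^+ n * h n.+1 by rewrite ler_peMl.
  nra.
apply: le_trans (main N (leqnn N)) _; apply: ler_wpM2r.
  rewrite addr_ge0// big_nat; apply: sumr_ge0 => k /andP[k0 kN].
  by apply: h0; rewrite k0.
rewrite expRM_natl lerXn2r ?nnegrE ?expR_ge0//; first exact: le_trans r1.
rewrite rE; exact: expR_ge1Dx.
Qed.

(** * The stability estimate for the scheme *)

Theorem theorem4p2 (R : realType) (d : nat) (hd : d = 2%N \/ d = 3%N)
    (Omega : set 'rV[R]_d) (hOmega : bounded_lipschitz_domain Omega)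
    (T : R) (hT : 0 < T)
    (* viscosity and a representative of its spatial gradient *)
    (nu : 'rV[R]_d -> R -> R) (Dnu : 'rV[R]_d -> R -> 'rV[R]_d)
    (nu_min : R) (hnu_min : 0 < nu_min)
    (hnu : forall x t, closed_cylinder Omega T (x, t) -> nu_min <= nu x t)
    (hDnu : {ae @lebesgue_measure R, forall t,
        0 <= t <= T -> weak_gradient Omega (nu ^~ t) (Dnu ^~ t)})
    (hDnu_inf : Linf Omega T Dnu)
    (* data *)
    (f : 'rV[R]_d -> R -> 'rV[R]_d) (hf : L2cyl Omega T f)
    (gamma eps alpha tau : R) (hgamma : 0 < gamma < 2) (heps : 0 < eps)
    (halpha : alpha = fine (Linf_norm Omega T Dnu) ^+ 2 / (gamma * nu_min)
                      + 1 / (eps * T))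
    (N : nat) (hN : (0 < N)%N) (htau : tau = T / N%:R)
    (htau_lt : tau < alpha^-1)
    (* values at the time nodes *)
    (hDnu_n : forall n, (n <= N)%N ->
        weak_gradient Omega (nu ^~ (n%:R * tau)) (Dnu ^~ (n%:R * tau)))
    (hDnu_inf_n : forall n, (n <= N)%N ->
        {ae lebesgue_rV R d, forall x, Omega x ->
          elen (Dnu x (n%:R * tau)) <= fine (Linf_norm Omega T Dnu)})
    (hf_n : forall n, (1 <= n <= N)%N -> L2mx Omega (f ^~ (n%:R * tau)))
    (* discrete solution; u 0 is the initial velocity *)
    (u : nat -> 'rV[R]_d -> 'rV[R]_d) (Du : nat -> 'rV[R]_d -> 'M[R]_d)
    (p : nat -> 'rV[R]_d -> R) (Dp : nat -> 'rV[R]_d -> 'rV[R]_d)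
    (hu0 : H10v Omega (u 0%N) (Du 0%N))
    (hdivu0 : {ae lebesgue_rV R d, forall x, Omega x ->
        divergence (Du 0%N) x = 0})
    (hp0 : p 0%N = cst 0) (hDp0 : Dp 0%N = cst 0)
    (hu : forall n, (n < N)%N -> H10v Omega (u n.+1) (Du n.+1))
    (hp : forall n, (n < N)%N -> H1mean0 Omega (p n.+1) (Dp n.+1))
    (* finiteness of the integrals weighted by the viscosity *)
    (hnu_int : forall n, (n < N)%N -> forall w Dw, H10v Omega w Dw ->
        (lebesgue_rV R d).-integrable Omega
          (fun x => (nu x (n%:R * tau) * ddot (Du n.+1 x) (Dw x))%:E))
    (* momentum equation; the previous pressure is p_{-1} = 0 when n = 0 *)
    (hmom : forall n, (n < N)%N -> forall w Dw, H10v Omega w Dw ->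
        tau^-1 * L2mxdot Omega (fun x => u n.+1 x - u n x) w
        + L2mxdot Omega (fun x => nu x (n%:R * tau) *: Du n.+1 x) Dw
        + L2mxdot Omega (gradmul (Du n.+1) (u n)) w
        + 2^-1 * L2mxdot Omega (fun x => divergence (Du n) x *: u n.+1 x) w
        = L2dot Omega
            (fun x => 2 * p n x - (if n is m.+1 then p m else cst 0) x)
            (divergence Dw)
          + L2mxdot Omega (gradTmul (Du n) (Dnu ^~ (n%:R * tau))) w
          + L2mxdot Omega w (f ^~ (n.+1%:R * tau)))
    (* pressure equation *)
    (hpres : forall n, (n < N)%N -> forall q Dq, H1mean0 Omega q Dq ->
        tau * L2mxdot Omega (fun x => Dp n.+1 x - Dp n x) Dq
        + L2dot Omega (divergence (Du n.+1)) q = 0) :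
  L2norm Omega (u N) ^+ 2
  + gamma * tau *
      L2norm Omega (fun x => Num.sqrt (nu x (N.-1%:R * tau)) *: Du N x) ^+ 2
  + tau ^+ 2 * L2norm Omega (Dp N) ^+ 2
  + \sum_(1 <= n < N.+1) tau *
      ((2 - gamma) *
         L2norm Omega (fun x => Num.sqrt (nu x (n.-1%:R * tau)) *: Du n x) ^+ 2
       + alpha * tau ^+ 2 * L2norm Omega (Dp n) ^+ 2)
  <= expR (alpha * T / (1 - alpha * tau)) *
     (L2norm Omega (u 0%N) ^+ 2
      + gamma * tau * nu_min * L2norm Omega (Du 0%N) ^+ 2
      + eps * T * \sum_(1 <= n < N.+1)
          tau * L2norm Omega (f ^~ (n%:R * tau)) ^+ 2).
Proof.
have oOmega : open Omega by case: hOmega.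
have bOmega : bounded_set Omega by case: hOmega.
have mOmega := open_measurable_rV oOmega.
have /andP[gamma0 gamma2] := hgamma.
set K := fine (Linf_norm Omega T Dnu) in halpha hDnu_inf_n.
have N0 : 0 < N%:R :> R by rewrite ltr0n.
have tau0 : 0 < tau by rewrite htau divr_gt0.
have NtauT : N%:R * tau = T by rewrite htau mulrC divfK ?gt_eqF.
have gnu0 : 0 < gamma * nu_min by rewrite mulr_gt0.
have epsT0 : 0 < eps * T by rewrite mulr_gt0.
have alpha0 : 0 < alpha.
  by rewrite halpha ltr_wpDl ?divr_ge0 ?sqr_ge0 ?(ltW gnu0)// divr_gt0.
have atau1 : alpha * tau < 1 by rewrite mulrC -ltr_pdivlMr// div1r.
have time_node n : (n <= N)%N -> 0 <= n%:R * tau <= T.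
  move=> nN; rewrite mulr_ge0 ?(ltW tau0)//= -NtauT.
  by rewrite ler_wpM2r ?(ltW tau0)// ler_nat.
have nu_ge n x : (n <= N)%N -> Omega x -> nu_min <= nu x (n%:R * tau).
  move=> nN Ox; apply: hnu; split; last exact: time_node.
  exact: subset_closure.
have Hu n : (n <= N)%N -> H10v Omega (u n) (Du n).
  by case: n => [//|n nN]; exact: hu.
have Hp n : (n <= N)%N -> H1mean0 Omega (p n) (Dp n).
  case: n => [_|n nN]; last exact: hp.
  rewrite hp0 hDp0; exact: H1mean0_0.
(* The pressure at index n - 1, with p_{-1} = 0 at n = 0 as in the momentum equation. *)
pose pm n := if n is m.+1 then p m else cst 0.
pose Dpm n := if n is m.+1 then Dp m else cst 0.
have Hpm n : (n <= N)%N -> H1mean0 Omega (pm n) (Dpm n).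
  by case: n => [_|n nN]; [exact: H1mean0_0|apply: Hp; exact: ltnW].
(* The viscous dissipation at level n, weighted with nu at the preceding node because the scheme
   pairs nu_n with u_{n+1}. No step produces level 0; its value is chosen to satisfy [AD] and
   becomes the term with grad u_0 in the final bound. *)
pose A n := if n is m.+1
  then L2norm Omega (fun x => Num.sqrt (nu x (m%:R * tau)) *: Du m.+1 x) ^+ 2
  else nu_min * L2norm Omega (Du 0%N) ^+ 2.
have A0 n : 0 <= A n.
  case: n => [|n]; last exact: sqr_ge0.
  by apply: mulr_ge0; [exact: ltW|exact: sqr_ge0].
have AE n : (n < N)%N ->
    L2mxdot Omega (fun x => nu x (n%:R * tau) *: Du n.+1 x) (Du n.+1) = A n.+1.
  move=> nN; rewrite /A L2norm_sqr; apply: eq_Rintegral => x /set_mem Ox.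
  rewrite /ddot; apply: eq_bigr => i _; apply: eq_bigr => j _; rewrite !mxE.
  have nu0 : 0 <= nu x (n%:R * tau).
    by apply: le_trans (ltW hnu_min) _; apply: nu_ge => //; exact: ltnW.
  by rewrite -[in LHS](sqr_sqrtr nu0); ring.
have AD n : (n <= N)%N -> nu_min * L2mxdot Omega (Du n) (Du n) <= A n.
  case: n => [_|n nN]; first by rewrite /A L2norm_sqr.
  have hD := H10v_gradL2 oOmega (Hu _ nN).
  have sD := L2mx_ddot_Rintegrable oOmega hD hD.
  have snu := hnu_int _ nN _ _ (Hu _ nN).
  rewrite -AE// -RintegralZl//.
  rewrite [leRHS](_ : _ = \int[lebesgue_rV R d]_(x in Omega)
    (nu x (n%:R * tau) * ddot (Du n.+1 x) (Du n.+1 x))); last first.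
    apply: eq_Rintegral => x _; rewrite /ddot mulr_sumr; apply: eq_bigr => i _.
    by rewrite mulr_sumr; apply: eq_bigr => j _; rewrite mxE mulrA.
  apply: le_Rintegral => //; first exact: RintegrableZ.
  move=> x Ox; rewrite ler_wpM2r ?ddot_ge0//.
  by apply: nu_ge => //; exact: ltnW.
have pres_prev n : (n < N)%N -> forall q Dq, H1mean0 Omega q Dq ->
    tau * L2mxdot Omega (fun x => Dp n x - Dpm n x) Dq
    + L2dot Omega (divergence (Du n)) q = 0.
  case: n => [_ q Dq Hq|n nN]; last exact: hpres (ltnW nN).
  rewrite /Dpm hDp0 (_ : L2mxdot _ _ _ = 0); last first.
    rewrite /L2mxdot (@eq_Rintegral _ _ _ _ _ (cst 0)); first by rewrite /Rintegral integral0.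
    move=> x _; rewrite /ddot big1// => i _; rewrite big1// => j _.
    by rewrite !mxE subr0 mul0r.
  rewrite mulr0 add0r /L2dot /Rintegral (ae_eq_integral (cst 0%E))//.
  - by rewrite integral0.
  - apply/measurable_EFinP; apply: measurable_funM; last by case: Hq => -[[]].
    by apply: measurable_sum => i; case: (H10v_gradL2 oOmega hu0 i i).
  - by apply: filterS hdivu0 => x h Ox; rewrite h// mul0r.
(* One-step energy balance: alpha tau |u_{n+1}|^2 gathers the Young remainders of the explicit
   viscous term and of the force. *)
have step n : (n < N)%N ->
    L2norm Omega (u n.+1) ^+ 2 + 2 * tau * A n.+1 + tau ^+ 2 * L2norm Omega (Dp n.+1) ^+ 2
    - alpha * tau * L2norm Omega (u n.+1) ^+ 2 <=
    L2norm Omega (u n) ^+ 2 + gamma * tau * A n + tau ^+ 2 * L2norm Omega (Dp n) ^+ 2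
    + eps * T * (tau * L2norm Omega (f ^~ (n.+1%:R * tau)) ^+ 2).
  move=> nN; rewrite !L2norm_sqr.
  have nN' := ltnW nN.
  have uL := H10v_L2 (Hu _ nN); have uL' := H10v_L2 (Hu _ nN').
  have DuL := H10v_gradL2 oOmega (Hu _ nN').
  have Hq := H1mean0_lin oOmega bOmega 2 (Hp _ nN') (Hpm _ nN').
  have Hdd := H1mean0_lin oOmega bOmega 1 (Hp _ nN) Hq.
  have pL : L2mx Omega (Dp n.+1) by case: (Hp _ nN) => -[].
  have pL' : L2mx Omega (Dp n) by case: (Hp _ nN') => -[].
  have pmL : L2mx Omega (Dpm n) by case: (Hpm _ nN') => -[].
  have hfn : L2mx Omega (f ^~ (n.+1%:R * tau)) by exact: hf_n.
  have hpL2 := L2mxZ oOmega 2 pL'.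
  have hqL := L2mxB oOmega hpL2 pmL.
  have hp1 := L2mxZ oOmega 1 pL.
  have hddL := L2mxB oOmega hp1 hqL.
  have hpp := L2mxB oOmega pL pL'.
  have hppm := L2mxB oOmega pL' pmL.
  have huu := L2mxB oOmega uL uL'.
  have M := hmom _ nN _ _ (Hu _ nN).
  have conv := convection_skew hd oOmega bOmega (Hu _ nN') (Hu _ nN).
  have Wq := hpres _ nN _ _ Hq.
  have Wd := hpres _ nN _ _ Hdd.
  have Wd' := pres_prev _ nN _ _ Hdd.
  rewrite (divergence_by_parts oOmega bOmega Hdd.1 (Hu _ nN)) in Wd.
  rewrite (divergence_by_parts oOmega bOmega Hdd.1 (Hu _ nN')) in Wd'.
  have G := L2mxdot_gradT_young oOmega gnu0 (e := Dnu ^~ (n%:R * tau)) (K := K) _ _ DuL uL.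
  have F := L2mxdot_young oOmega epsT0 uL hfn.
  have {}G : 2 * L2mxdot Omega (gradTmul (Du n) (Dnu ^~ (n%:R * tau))) (u n.+1) <=
      gamma * nu_min * L2mxdot Omega (Du n) (Du n) +
      K ^+ 2 / (gamma * nu_min) * L2mxdot Omega (u n.+1) (u n.+1).
    apply: G; last exact: hDnu_inf_n.
    by move=> i; have [_ /(_ i)[[]]] := hDnu_n _ nN'.
  set V := fun x => 1 *: Dp n.+1 x - (2 *: Dp n x - Dpm n x) in hddL Wd Wd'.
  have tV := L2mxZ oOmega tau hddL.
  (* [V] is grad d_n. The difference of the two pressure equations gives (u_{n+1} - u_n, V) = tau
     |V|^2, so expanding this square yields tau^2 |V|^2 <= |u_{n+1} - u_n|^2. *)
  have S1 := L2mxdot_ge0 Omega (fun x => (u n.+1 x - u n x) - tau *: V x).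
  (* The remainder of the telescoping: |V|^2 plus twice the tested pressure term equals |grad
     p_{n+1}|^2 - |grad p_n|^2 + |grad (p_n - p_{n-1})|^2. *)
  have S2 := L2mxdot_ge0 Omega (fun x => Dp n x - Dpm n x).
  have VV : L2mxdot Omega V V = L2mxdot Omega (fun x => Dp n.+1 x - Dp n x) V -
      L2mxdot Omega (fun x => Dp n x - Dpm n x) V.
    rewrite -L2mxdotBl//; congr (L2mxdot _ _ _); apply/funext => x; rewrite /V.
    by rewrite scale1r scaler_nat mulr2n; apply/rowP => i; rewrite !mxE; ring.
  have {}S1 : 0 <= L2mxdot Omega (u n.+1) (u n.+1) - 2 * L2mxdot Omega (u n.+1) (u n)
      + L2mxdot Omega (u n) (u n)
      - 2 * tau * (L2mxdot Omega (u n.+1) V - L2mxdot Omega (u n) V)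
      + tau ^+ 2 * L2mxdot Omega V V.
    move: S1; rewrite L2mxdotBB// L2mxdotZl// !L2mxdotZr//.
    rewrite (L2mxdotBl oOmega uL uL' hddL) (L2mxdotBB oOmega uL uL').
    by move=> S1; apply: le_trans S1 _; rewrite le_eqVlt; apply/orP; left; apply/eqP; ring.
  have {}S2 : 0 <= L2mxdot Omega (Dp n) (Dp n) - 2 * L2mxdot Omega (Dp n) (Dpm n)
      + L2mxdot Omega (Dpm n) (Dpm n).
    by rewrite -L2mxdotBB.
  have VE : L2mxdot Omega V V = L2mxdot Omega (Dp n.+1) (Dp n.+1)
      + 4 * L2mxdot Omega (Dp n) (Dp n) + L2mxdot Omega (Dpm n) (Dpm n)
      - 4 * L2mxdot Omega (Dp n.+1) (Dp n) + 2 * L2mxdot Omega (Dp n.+1) (Dpm n)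
      - 4 * L2mxdot Omega (Dp n) (Dpm n).
    rewrite /V L2mxdotBB// !L2mxdotZl// !L2mxdotZr// !L2mxdotBB// !L2mxdotBr//.
    by rewrite !L2mxdotZl// !L2mxdotZr//; ring.
  have WqE : L2mxdot Omega (fun x => Dp n.+1 x - Dp n x)
      (fun x => 2 *: Dp n x - Dpm n x) =
      2 * L2mxdot Omega (Dp n.+1) (Dp n) - L2mxdot Omega (Dp n.+1) (Dpm n)
      - 2 * L2mxdot Omega (Dp n) (Dp n) + L2mxdot Omega (Dp n) (Dpm n).
    by rewrite L2mxdotBl// !L2mxdotBr// !L2mxdotZr//; ring.
  rewrite L2mxdotBl// AE// in M.
  have qC : L2dot Omega (fun x => 2 * p n x - pm n x) (divergence (Du n.+1)) =
      L2dot Omega (divergence (Du n.+1)) (fun x => 2 * p n x - pm n x).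
    by apply: eq_Rintegral => x _; exact: mulrC.
  rewrite [L2dot _ _ _]qC (L2mxdotC _ (u n)) in M.
  move: M conv Wq Wd Wd' S1 S2 G F VV VE WqE (AD _ nN').
  set c1 := L2mxdot Omega (gradmul _ _) _.
  set c2 := L2mxdot Omega (fun x => divergence _ _ *: _) _.
  set qd := L2dot _ _ _; set a := L2mxdot Omega (u n.+1) (u n.+1).
  set b := L2mxdot Omega (u n.+1) (u n); set c := L2mxdot Omega (u n) (u n).
  set gg := L2mxdot Omega (gradTmul _ _) _.
  set ff := L2mxdot Omega (u n.+1) (f ^~ _).
  set f2 := L2mxdot Omega (f ^~ _) _.
  set D := L2mxdot Omega (Du n) (Du n).
  set v := L2mxdot Omega V V.
  set x1 := L2mxdot Omega (u n.+1) V; set x0 := L2mxdot Omega (u n) V.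
  set y1 := L2mxdot Omega (fun x => Dp n.+1 x - Dp n x) V.
  set y0 := L2mxdot Omega (fun x => Dp n x - Dpm n x) V.
  set wq := L2mxdot Omega (fun x => Dp n.+1 x - Dp n x) _.
  set p11 := L2mxdot Omega (Dp n.+1) (Dp n.+1).
  set p10 := L2mxdot Omega (Dp n.+1) (Dp n).
  set p1m := L2mxdot Omega (Dp n.+1) (Dpm n).
  set p00 := L2mxdot Omega (Dp n) (Dp n).
  set p0m := L2mxdot Omega (Dp n) (Dpm n).
  set pmm := L2mxdot Omega (Dpm n) (Dpm n).
  move=> M conv Wq Wd Wd' S1 S2 G F VV VE WqE ADn.
  have M' : 2 * (a - b) + 2 * tau * A n.+1 = 2 * tau * (qd + gg + ff).
    have tt : tau * tau^-1 = 1 by rewrite divff// gt_eqF.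
    rewrite -M [RHS](_ : _ = 2 * (tau * tau^-1) * (a - b) + 2 * tau * A n.+1
      + 2 * tau * (c1 + 2^-1 * c2)); last by ring.
    by rewrite tt conv mulr1 mulr0 addr0.
  have qdE : qd = - (tau * wq) by lra.
  (* The right-hand side is |u_{n+1} - u_n|^2, exactly what 2 (a - b) contains beyond a - c. *)
  have TV : tau ^+ 2 * v <= a - 2 * b + c.
    have x10 : x1 - x0 = tau * v by rewrite VV; lra.
    by rewrite x10 in S1; lra.
  have TS := mulr_ge0 (sqr_ge0 tau) S2.
  have TG : tau * (2 * gg) <= tau * (gamma * A n + K ^+ 2 / (gamma * nu_min) * a).
    rewrite ler_pM2l//; apply: le_trans G _; rewrite lerD2r -mulrA.
    by rewrite ler_pM2l.
  have TF : tau * (2 * ff) <= tau * ((eps * T)^-1 * a + eps * T * f2).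
    by rewrite ler_pM2l.
  have aa : alpha * tau * a = tau * (K ^+ 2 / (gamma * nu_min) * a) + tau * ((eps * T)^-1 * a).
    by rewrite halpha div1r; ring.
  (* The inequalities were multiplied by powers of tau beforehand, so the conclusion is linear in
     the remaining products. *)
  rewrite aa; move: TV M'; rewrite VE qdE WqE; lra.
(* The dissipation 2 tau A splits into gamma tau A in [e] and (2 - gamma) tau A in [g]. The pressure
   part of [g] cancels the pressure part of alpha tau e. *)
pose e n := L2norm Omega (u n) ^+ 2 + gamma * tau * A n + tau ^+ 2 * L2norm Omega (Dp n) ^+ 2.
pose g n := tau * ((2 - gamma) * A n + alpha * tau ^+ 2 * L2norm Omega (Dp n) ^+ 2).
pose h n := eps * T * (tau * L2norm Omega (f ^~ (n%:R * tau)) ^+ 2).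
have := @discrete_gronwall R (alpha * tau) N e g h.
rewrite mulr_ge0 ?(ltW alpha0) ?(ltW tau0)//= atau1.
have E0 : e 0%N = L2norm Omega (u 0%N) ^+ 2 + gamma * tau * nu_min * L2norm Omega (Du 0%N) ^+ 2.
  rewrite /e /= hDp0 (_ : L2norm _ (cst 0) ^+ 2 = 0) ?mulr0 ?addr0 ?mulrA//.
  rewrite L2norm_sqr /L2mxdot (@eq_Rintegral _ _ _ _ _ (cst 0)).
    by rewrite /Rintegral integral0.
  by move=> x _; rewrite /ddot big1// => i _; rewrite big1// => j _; rewrite !mxE mul0r.
have AS n : (0 < n)%N -> A n =
    L2norm Omega (fun x => Num.sqrt (nu x (n.-1%:R * tau)) *: Du n x) ^+ 2.
  by case: n.
have EN : e N = L2norm Omega (u N) ^+ 2 + gamma * tau *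
    L2norm Omega (fun x => Num.sqrt (nu x (N.-1%:R * tau)) *: Du N x) ^+ 2
    + tau ^+ 2 * L2norm Omega (Dp N) ^+ 2.
  by rewrite /e AS.
have expE : N%:R * (alpha * tau / (1 - alpha * tau)) = alpha * T / (1 - alpha * tau).
  by rewrite -NtauT; ring.
have sumg : \sum_(1 <= n < N.+1) g n = \sum_(1 <= n < N.+1) tau *
      ((2 - gamma) *
         L2norm Omega (fun x => Num.sqrt (nu x (n.-1%:R * tau)) *: Du n x) ^+ 2
       + alpha * tau ^+ 2 * L2norm Omega (Dp n) ^+ 2).
  by apply: eq_big_nat => -[|n].
have sumh : \sum_(1 <= n < N.+1) h n = eps * T * \sum_(1 <= n < N.+1)
          tau * L2norm Omega (f ^~ (n%:R * tau)) ^+ 2 by rewrite mulr_sumr.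
rewrite E0 EN expE sumg sumh; apply => //.
- move=> n; apply: addr_ge0; last by apply: mulr_ge0; exact: sqr_ge0.
  apply: addr_ge0; first exact: sqr_ge0.
  by apply: mulr_ge0 (A0 n); apply: mulr_ge0; exact: ltW.
- move=> n; apply: mulr_ge0; first exact: ltW.
  apply: addr_ge0; first by apply: mulr_ge0 (A0 n); rewrite subr_ge0 ltW.
  by apply: mulr_ge0; rewrite ?sqr_ge0// mulr_ge0 ?sqr_ge0// ltW.
- move=> n _; apply: mulr_ge0; first exact: ltW.
  by apply: mulr_ge0 (sqr_ge0 _); exact: ltW.
move=> n nN; have := step n nN; rewrite /e /g /h.
(* The only part of alpha tau e that nothing compensates; it has the favourable sign and is
   dropped. *)
have : 0 <= alpha * tau * (gamma * tau * A n.+1).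
  by apply: mulr_ge0; apply: mulr_ge0; rewrite ?A0 ?mulr_ge0// ltW.
lra.
Qed.
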